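(* Let $m,n\ge 1$ be integers. The map $\tau\mapsto \mathbb{T}_\tau$ is a bijection between the set of triangulations of $\Delta_{[m]}\times\Delta_{[\bar n]}$ and the set of trianguloids $\mathbb{T}:E(\Gamma)\to 2^{[\bar n]}$.
   Context: Let $[m]=\{1,\dots,m\}$ and let $[\bar n]=\{\bar 1,\dots,\bar n\}$ be a disjoint set of $n$ symbols. $K_{m,n}$ is the complete bipartite graph with vertex set $[m]\cup[\bar n]$ and edges $(i,\bar j)$, $i\in[m],\bar j\in[\bar n]$; subgraphs are identified with their edge sets. Let $e_1,\dots,e_m,e_{\bar 1},\dots,e_{\bar n}$ be the standard basis of $\mathbb{R}^{m+n}$. Triangulations. For $F\subset K_{m,n}$ let $\Delta_F$ be the convex hull of the points $e_i-e_{\bar j}$, $(i,\bar j)\in F$. The product $\Delta_{[m]}\times\Delta_{[\bar n]}$ of two simplices is identified with the root polytope $Q_{K_{m,n}}=\Delta_{K_{m,n}}$. A forest is a set of edges containing no cycle; $\Delta_F$ is a simplex exactly when $F$ is a forest. A triangulation $\tau$ of $Q_{K_{m,n}}$ is a simplicial complex each of whose simplices has the form $\Delta_F$ for a forest $F\subset K_{m,n}$, such that any two simplices $\Delta_F,\Delta_{F'}\in\tau$ satisfy $\Delta_F\cap\Delta_{F'}=\Delta_{F\cap F'}$, and the union of the simplices is $Q_{K_{m,n}}$. $\mathcal{T}(\tau)$ denotes the set of spanning trees $T$ of $K_{m,n}$ with $\Delta_T\in\tau$. For a spanning tree $T$, $\mathrm{LD}^-(T)=(\deg_1(T)-1,\dots,\deg_m(T)-1)$,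 where $\deg_i(T)$ is the degree of $i$ in $T$. Lattice points. $\Delta^{\mathbb Z}(m,k)$ is the set of vectors in $\mathbb{Z}_{\ge0}^m$ with coordinate sum $k$ (empty if $k<0$). The graph $\Gamma$. $\Gamma$ is the directed graph with vertex set $\Delta^{\mathbb Z}(m,n-1)\sqcup\Delta^{\mathbb Z}(m,n)$ and edge set $E(\Gamma)=\{b\to b+e_i: b\in\Delta^{\mathbb Z}(m,n-1), i\in[m]\}$. A pre-trianguloid is a map $\mathbb{T}:E(\Gamma)\to2^{[\bar n]}$ such that: (T1) $|\mathbb{T}(a-e_i\to a)|=a_i$ for every edge $(a-e_i\to a)\in E(\Gamma)$; (T2) for each $a\in\Delta^{\mathbb Z}(m,n)$ and $\bar j\in[\bar n]$ there is $i\in[m]$ (with $(a-e_i\to a)\in E(\Gamma)$) such that $\bar j\in\mathbb{T}(a-e_i\to a)$; (T3) if $a$ and $a':=a+e_i-e_j$ both belong to $\Delta^{\mathbb Z}(m,n)$ and $a_i>0$, then $\mathbb{T}(a-e_i\to a)\subset\mathbb{T}(a'-e_i\to a')$. A trianguloid is a pre-trianguloid satisfying the Hexagon axiom: (T4) if $c\in\Delta^{\mathbb Z}(m,n-2)$ and $i,j,k\in[m]$ are distinct with $\mathbb{T}(c+e_i\to c+e_i+e_j)\ne\mathbb{T}(c+e_k\to c+e_k+e_j)$, then $\mathbb{T}(c+e_i\to c+e_i+e_k)=\mathbb{T}(c+e_j\to c+e_j+e_k)$ and $\mathbb{T}(c+e_j\to c+e_j+e_i)=\mathbb{T}(c+e_k\to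 c+e_k+e_i)$. The map $\mathbb{T}_\tau$. It is known (Postnikov) that for a triangulation $\tau$ of $Q_{K_{m,n}}$ and each $b\in\Delta^{\mathbb Z}(m,n-1)$ there is a unique $T_\tau(b)\in\mathcal{T}(\tau)$ with $\mathrm{LD}^-(T_\tau(b))=b$. Define $\mathbb{T}_\tau:E(\Gamma)\to2^{[\bar n]}$ by $\mathbb{T}_\tau(b\to b+e_i)=\{\bar j: (i,\bar j)\in T_\tau(b)\}$. *)

(* Defs.v *)
From HB Require Import structures.
From mathcomp Require Import all_boot all_order all_algebra.
From mathcomp Require Import all_classical reals.

Set Implicit Arguments.
Unset Strict Implicit.
Unset Printing Implicit Defensive.

Import Order.TTheory GRing.Theory Num.Theory.
Local Open Scope classical_set_scope.
Local Open Scope ring_scope.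

(* A subgraph of the complete bipartite graph is its set of edges:
   (i, j) stands for the edge joining the left vertex i to the right vertex
   j.  Vertices are 'I_m + 'I_n, numbered from 0. *)
Section Subgraphs.
Variables m n : nat.
Implicit Types F : {set 'I_m * 'I_n}.

Definition adj F : rel ('I_m + 'I_n) := fun u v =>
  match u, v with
  | inl i, inr j | inr j, inl i => (i, j) \in F
  | _, _ => false
  end.

(* [ucycle] also accepts the empty sequence and the back-and-forth walk along
   a single edge, which are not cycles of a simple graph. *)
Definition is_forest F : Prop :=
  forall c : seq ('I_m + 'I_n), ucycle (adj F) c -> (size c <= 2)%N.

Definition is_spanning_tree F : Prop :=
  is_forest F /\ forall u v, connect (adj F) u v.

Definition ldeg F (i : 'I_m) : nat := #|[set j | (i, j) \in F]%SET|.

Definition LDminus F : 'rV[int]_m := \row_i ((ldeg F i)%:Z - 1).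

End Subgraphs.

Section Triangulations.
Variables (R : realType) (m n : nat).
Implicit Types (F : {set 'I_m * 'I_n}) (tau : set (set 'rV[R]_(m + n))).

Definition root_point (e : 'I_m * 'I_n) : 'rV[R]_(m + n) :=
  delta_mx 0 (lshift n e.1) - delta_mx 0 (rshift m e.2).

(* Convex hull of the finitely many points [root_point e], [e \in F]; it is
   empty when F is empty. *)
Definition root_hull F : set 'rV[R]_(m + n) :=
  [set x | exists w : 'I_m * 'I_n -> R,
     [/\ forall e, e \in F -> 0 <= w e,
         \sum_(e in F) w e = 1 &
         x = \sum_(e in F) w e *: root_point e]].

Definition root_polytope : set 'rV[R]_(m + n) :=
  root_hull [set: 'I_m * 'I_n]%SET.

(* A triangulation is a set of simplices, i.e. of subsets of R^(m+n).  As in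
   any simplicial complex it contains the faces of its members; for a forest F
   the faces of [root_hull F] are the [root_hull F'] with F' \subset F.  The
   empty simplex is counted as a face, so that the intersection of two
   simplices is always a simplex. *)
Definition is_triangulation tau : Prop :=
  [/\ forall s, tau s -> exists F, is_forest F /\ s = root_hull F,
      forall F F', is_forest F -> tau (root_hull F) -> F' \subset F ->
        tau (root_hull F'),
      forall F F', is_forest F -> is_forest F' ->
        tau (root_hull F) -> tau (root_hull F') ->
        root_hull F `&` root_hull F' = root_hull (F :&: F')%SET &
      \bigcup_(s in tau) s = root_polytope].

Definition triangulation_trees tau : set {set 'I_m * 'I_n} :=
  [set T | is_spanning_tree T /\ tau (root_hull T)].

(* For a triangulation tau and a nonnegative b with coordinate sum n - 1 there
   is exactly one such tree (Postnikov), so the default value of [xget] is then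
   not used. *)
Definition tree_of tau (b : 'rV[int]_m) : {set 'I_m * 'I_n} :=
  xget finset.set0 [set T | triangulation_trees tau T /\ LDminus T = b].

End Triangulations.

Definition lattice_simplex (m : nat) (k : int) : pred 'rV[int]_m :=
  fun a => [forall i, 0 <= a 0 i] && (\sum_i a 0 i == k).

Arguments lattice_simplex : clear implicits.

Definition unit_vec (m : nat) (i : 'I_m) : 'rV[int]_m := delta_mx 0 i.

Section Trianguloids.
Variables m n : nat.
Local Notation e_ := (@unit_vec m).

(* E(Gamma): an edge b -> a is the pair (b, a). *)
Definition is_edge : pred ('rV[int]_m * 'rV[int]_m) := fun p =>
  (p.1 \in lattice_simplex m (n%:Z - 1)) && [exists i, p.2 == p.1 + e_ i].

Definition edge : Type := {p : 'rV[int]_m * 'rV[int]_m | is_edge p}.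

(* Value of T on the edge b -> a; the default value is taken only when
   (b, a) is not an edge. *)
Definition at_edge (T : edge -> {set 'I_n}) (b a : 'rV[int]_m) : {set 'I_n} :=
  if insub (b, a) is Some e then T e else finset.set0.

Definition is_pre_trianguloid (T : edge -> {set 'I_n}) : Prop :=
  [/\ forall (a : 'rV[int]_m) (i : 'I_m), is_edge (a - e_ i, a) ->
        #|at_edge T (a - e_ i) a|%:Z = a 0 i,
      forall (a : 'rV[int]_m) (j : 'I_n), a \in lattice_simplex m n%:Z ->
        exists i, is_edge (a - e_ i, a) /\ j \in at_edge T (a - e_ i) a &
      forall (a : 'rV[int]_m) (i j : 'I_m), let a' := a + e_ i - e_ j in
        a \in lattice_simplex m n%:Z -> a' \in lattice_simplex m n%:Z ->
        0 < a 0 i ->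
        at_edge T (a - e_ i) a \subset at_edge T (a' - e_ i) (a')].

Definition hexagon_axiom (T : edge -> {set 'I_n}) : Prop :=
  forall (c : 'rV[int]_m) (i j k : 'I_m), c \in lattice_simplex m (n%:Z - 2) ->
    i != j -> j != k -> i != k ->
    at_edge T (c + e_ i) (c + e_ i + e_ j) <> at_edge T (c + e_ k) (c + e_ k + e_ j) ->
    at_edge T (c + e_ i) (c + e_ i + e_ k) = at_edge T (c + e_ j) (c + e_ j + e_ k) /\
    at_edge T (c + e_ j) (c + e_ j + e_ i) = at_edge T (c + e_ k) (c + e_ k + e_ i).

Definition is_trianguloid (T : edge -> {set 'I_n}) : Prop :=
  is_pre_trianguloid T /\ hexagon_axiom T.

End Trianguloids.

(* The index i below is the unique one with target b + e_i. *)
Definition trianguloid_of (R : realType) (m n : nat)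
    (tau : set (set 'rV[R]_(m + n))) : edge m n -> {set 'I_n} := fun e =>
  [set j | [exists i, ((val e).2 == (val e).1 + unit_vec i)
                      && ((i, j) \in tree_of tau (val e).1)]]%SET.

(* Main.v *)
Require Import Defs.
From mathcomp Require Import all_boot all_order all_algebra.
From mathcomp Require Import all_classical reals.
From mathcomp Require Import fintype finset zify ring lra.

(** A point of the cone over the root polytope is a transportation problem: a
supply [p] on the left vertices and a demand [q] on the right vertices.  It
lies over the simplex of a forest [F] exactly when some nonnegative flow
supported on [F] has these marginals.  Points are represented here by
matrices [x], and two matrices stand for the same point when every vertex set
[S] has the same [excess S] (demand minus supply inside [S]).  Removing an
edge [e] from a tree splits the vertices in two, and the only possible flow
through [e] is the excess of the side that contains its right end
([flow_cut], [excess_tree]).  Hence membership in simplices is decided by the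
signs of finitely many linear forms, one for each cut.

The barycentre [(b + 1/m, 1)] attached to [b] controls which tree has left
degrees [b + 1]: a forest carrying it nonnegatively is connected, because no
proper cut has excess zero ([barycentre_generic], [connected_of_generic]), and
has these degrees, because each flow value is at most 1 ([barycentre_degree]);
conversely any tree with these degrees carries it with positive flow
([barycentre_cut]).  This yields existence and uniqueness of the tree of [b]
in a triangulation.  The integral points [(a, 1)] lie, for every [i] with
[a_i > 0], over the tree of [a - e_i], and their flows there take the values 0
and 1; since two simplices of a triangulation cannot carry different flows of
one point, the axioms of a trianguloid follow ([triangulation_colouring]).
The triangulation is recovered from its trees because each of its simplices
lies in one of them ([simplex_in_tree]).

Conversely, a trianguloid assigns to each [b] a graph [col_graph b].  It
carries the integral points [(b + e_k, 1)] for all [k], hence also their mean,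
the barycentre, so it is connected, and it has [m + n - 1] edges: it is a tree
([col_graph_tree]).  The hexagon axiom yields a strict partial order on the left
vertices across an edge [(k, j)], and exchanging [(k, j)] for an edge at a
maximal one gives the graph of another lattice point
([flip], [flip_flipped]).  So the trees behave like the facets of a
pseudomanifold: when a point moves across a single wall, every tree that ceases
to cover it is replaced by exactly one other tree ([crossing_covers],
[flipped_inj]).  A path in general position between two generic points crosses
one wall at a time ([walk]).  A barycentre is covered by exactly one tree;
walking from or to it shows that every generic point is covered by exactly one
tree, which is the covering property ([col_graph_cover]).  Walking only near a
given point [z], one never crosses the walls of the edges that carry [z], so
two trees that both carry [z] lead to a single tree that contains the supports
of both flows, and these flows then coincide ([col_graph_compatible]). *)

Set Implicit Arguments.
Unset Strict Implicit.
Unset Printing Implicit Defensive.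

Import Order.TTheory GRing.Theory Num.Theory.
Local Open Scope ring_scope.

(** * Forests and spanning trees of the complete bipartite graph *)

Section Graphs.
Variables m n : nat.
Local Notation V := ('I_m + 'I_n)%type.
Implicit Types (F : {set 'I_m * 'I_n}) (e f : 'I_m * 'I_n) (u v : V).

Lemma adjC F u v : adj F u v = adj F v u.
Proof. by case: u v => [i|j] [k|l]. Qed.

Lemma connect_adjC F : connect_sym (adj F).
Proof. exact/sym_connect_sym/adjC. Qed.

Lemma sub_adj F F' : F \subset F' -> subrel (adj F) (adj F').
Proof. by move=> /subsetP sF [i|j] [k|l] //=; apply: sF. Qed.

Lemma sub_forest F F' : F' \subset F -> is_forest F -> is_forest F'.
Proof.
move=> sF FF c /andP[cc uc]; apply: FF; apply/andP; split=> //.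
exact: sub_cycle (sub_adj sF) _ cc.
Qed.

Lemma adj_edge F e : e \in F -> adj F (inl e.1) (inr e.2).
Proof. by case: e. Qed.

Lemma forest_bridge F e : is_forest F -> e \in F ->
  ~~ connect (adj (F :\ e)) (inr e.2) (inl e.1).
Proof.
move=> FF eF; apply/negP => /connectP[p0 pp lp].
case/shortenP: pp lp => p pp up _ lp.
have /FF : ucycle (adj F) (inr e.2 :: p).
  apply/andP; split=> //=; rewrite rcons_path.
  rewrite (sub_path (sub_adj (subsetDl _ _)) pp) -lp.
  exact: adj_edge.
case: p pp up lp => [|u [|v p]] //= /andP[].
by case: u => // i /= + _ _ [ie]; rewrite -ie !inE -surjective_pairing eqxx.
Qed.

(** The walk leaves [u] and [v] behind after the first step and meets them again
at most at its end, so none of its steps can be the edge between them. *)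
Lemma avoiding_path F e u v x s : 
  adj F u v -> (forall a b, adj F a b -> ~~ adj (F :\ e) a b ->
     (a == u) && (b == v) || (a == v) && (b == u)) ->
  path (adj F) x (rcons s u) -> u \notin x :: s -> v \notin x :: s ->
  path (adj (F :\ e)) x (rcons s u).
Proof.
move=> auv ae; elim: s x => [|y s IH] x /=.
  rewrite !inE !andbT eq_sym => axu xu; rewrite eq_sym => xv; apply/negPn/negP => na.
  by case/orP: (ae _ _ axu na) => /andP[]; rewrite ?(negPf xu) ?(negPf xv).
rewrite inE negb_or => /andP[axy pys] /andP[xu uys].
rewrite inE negb_or => /andP[xv vys].
rewrite IH // andbT; apply/negPn/negP => na.
case/orP: (ae _ _ axy na) => /andP[]; rewrite eq_sym.
  by rewrite (negPf xu).
by rewrite (negPf xv).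
Qed.

(** The rest of a cycle joins the ends of any of its edges without using it. *)
Lemma bridge_forest F :
  (forall e, e \in F -> ~~ connect (adj (F :\ e)) (inr e.2) (inl e.1)) ->
  is_forest F.
Proof.
move=> br [|u [|v [|w s]]] // /andP[/= /andP[auv /andP[avw pw]]].
rewrite !inE !negb_or => /andP[/and3P[uv uw us] /andP[/andP[vw vs] _]].
have key e : e \in F -> (forall a b, adj F a b -> ~~ adj (F :\ e) a b ->
     (a == u) && (b == v) || (a == v) && (b == u)) -> connect (adj (F :\ e)) v u.
  move=> eF ae; apply/connectP; exists (w :: rcons s u); last by rewrite /= last_rcons.
  rewrite /= (@avoiding_path _ _ u v) ?andbT // ?inE ?negb_or ?uw ?vw //.
  apply/negPn/negP => na; case/orP: (ae _ _ avw na) => /andP[].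
    by rewrite eq_sym (negPf uv).
  by rewrite (eq_sym w) (negPf uw).
case: u v auv {avw pw uv uw us vw vs} key => [i|j] [k|l] //= eF key.
- have := br _ eF; rewrite key //.
  case=> [a|a] [b|b] //= abF; rewrite !inE abF andbT negbK => /eqP[-> ->];
  by rewrite !eqxx ?orbT.
- have := br _ eF; rewrite connect_adjC key //.
  case=> [a|a] [b|b] //= abF; rewrite !inE abF andbT negbK => /eqP[-> ->];
  by rewrite !eqxx ?orbT.
Qed.

(** The cut is oriented: it is the side of the right end of [e]. With this choice
the flow through [e] is the excess of the cut with a plus sign. *)
Definition cut F e : {set V} := [set v | connect (adj (F :\ e)) (inr e.2) v].

Lemma cut_right F e : inr e.2 \in cut F e.
Proof. by rewrite inE connect0. Qed.

Lemma cut_left F e : is_forest F -> e \in F -> inl e.1 \notin cut F e.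
Proof. by move=> FF eF; rewrite inE forest_bridge. Qed.

Lemma cut_other F e f : f \in F -> f != e ->
  (inl f.1 \in cut F e) = (inr f.2 \in cut F e).
Proof.
move=> fF fe; rewrite !inE.
have a : adj (F :\ e) (inl f.1) (inr f.2) by apply: adj_edge; rewrite !inE fe.
apply/idP/idP => c; apply: connect_trans c (connect1 _) => //.
Qed.

Definition inside (S : {set V}) e := (inl e.1 \in S) && (inr e.2 \in S).

(** Induction on the number of edges: removing an edge splits [S] into the two
sides of its cut, and the remaining edges lie inside one of the two. *)
Lemma forest_card_le F (S : {set V}) u : is_forest F -> u \in S ->
  (forall e, e \in F -> inside S e) -> (#|F| < #|S|)%N.
Proof.
have [N] := ubnP #|F|; elim: N => // N IH in F S u *; rewrite ltnS => leF FF uS inS.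
have [->|[e eF]] := set_0Vmem F; first by rewrite cards0 card_gt0; apply/set0Pn; exists u.
have /andP[e1S e2S] := inS _ eF.
have cF : (#|F :\ e| < N)%N by rewrite (cardsD1 e) eF in leF.
pose P := [set f | inside (cut F e) f].
have h1 : (#|(F :\ e) :&: P| < #|S :&: cut F e|)%N.
  apply: (IH _ _ (inr e.2)); rewrite ?inE ?e2S ?cut_right //.
  - by apply: leq_ltn_trans cF; rewrite subset_leq_card // subsetIl.
  - by apply: sub_forest FF; apply: subset_trans (subsetIl _ _) (subsetDl _ _).
  - by rewrite connect0.
  - move=> f; rewrite inE [_ \in P]inE => /andP[/setD1P[fe fF]].
    by rewrite /inside => /andP[a b]; rewrite ![_ \in _ :&: _]inE a b;
      move: (inS _ fF) => /andP[-> ->].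
have h2 : (#|(F :\ e) :\: P| < #|S :\: cut F e|)%N.
  apply: (IH _ _ (inl e.1)).
  - by apply: leq_ltn_trans cF; rewrite subset_leq_card // subsetDl.
  - by apply: sub_forest FF; apply: subset_trans (subsetDl _ _) (subsetDl _ _).
  - by rewrite inE e1S cut_left.
  - move=> f; rewrite inE [_ \in P]inE => /andP[+ /setD1P[fe fF]].
    rewrite /inside (cut_other fF fe) andbb => nf.
    rewrite ![_ \in _ :\: _]inE; rewrite (cut_other fF fe) (negPf nf) /=; exact: inS.
have := cardsID (cut F e) S; have := cardsID P (F :\ e); have := cardsD1 e F.
rewrite eF => -> <- <-; rewrite add1n -addSn -addnS; exact: leq_add.
Qed.

(** The incidence vectors [e_u - e_v] of a connected graph span all differences of
unit vectors, so together with one unit vector they span the whole space. *)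
Lemma connected_card F : (0 < m)%N -> (forall u v, connect (adj F) u v) -> (m + n <= #|F|.+1)%N.
Proof.
move=> hm cF.
pose E (u : V) : 'rV[rat]_(m + n) := delta_mx 0 (unsplit u).
pose M := \matrix_(k < #|F|) (E (inl (enum_val k).1) - E (inr (enum_val k).2)).
have EM u v : (E u - E v <= M)%MS.
  have /connectP[p pp ->] := cF u v; elim: p u pp => [|w p IH] u /=.
    by rewrite subrr sub0mx.
  move=> /andP[auw pw]; rewrite -(subrKA (E w)); apply: addmx_sub; last exact: IH.
  have eM e : e \in F -> (E (inl e.1) - E (inr e.2) <= M)%MS.
    move=> eF; have -> : E (inl e.1) - E (inr e.2) = row (enum_rank_in eF e) M.
      by rewrite rowK enum_rankK_in.
    exact: row_sub.
  case: u w auw {pw} => [i|j] [k|l] //= h; first exact: (eM _ h).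
  by rewrite -opprB eqmx_opp; exact: (eM _ h).
pose r : V := inl (Ordinal hm).
have : (1%:M <= col_mx M (E r))%MS.
  apply/row_subP => k; rewrite row1 -(subrK (E r) (delta_mx 0 k)) -addsmxE.
  apply: addmx_sub; last exact: addsmxSr.
  apply: submx_trans (addsmxSl _ _); rewrite -(splitK k); exact: EM.
move/mxrankS; rewrite mxrank1 => /leq_trans -> //.
by apply: leq_trans (rank_leq_row _) _; rewrite addn1.
Qed.

Lemma tree_card F : (0 < m)%N -> is_spanning_tree F -> #|F|.+1 = (m + n)%N.
Proof.
move=> hm [FF cF]; apply/eqP; rewrite eqn_leq connected_card // andbT.
have := @forest_card_le F finset.setT (inl (Ordinal hm)) FF (in_setT _).
by rewrite cardsT card_sum !card_ord; apply => e _; rewrite /inside !in_setT.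
Qed.

(** If the ends of an edge remained connected after its removal, the smaller graph
would still be connected, with too few edges. *)
Lemma connected_tree F : (0 < m)%N -> (forall u v, connect (adj F) u v) ->
  #|F|.+1 = (m + n)%N -> is_spanning_tree F.
Proof.
move=> hm cF cardF; split=> //; apply: bridge_forest => e eF; apply/negP => ce.
suff /(connected_card hm) : forall u v, connect (adj (F :\ e)) u v.
  by rewrite -cardF (cardsD1 e F) eF ltnn.
move=> u v; have := cF u v; apply: connect_sub => {u v} u v auv.
case: (boolP (adj (F :\ e) u v)) => [/connect1//|na].
suff [[-> ->]|[-> ->]] : u = inr e.2 /\ v = inl e.1 \/ u = inl e.1 /\ v = inr e.2.
- by [].
- by rewrite connect_adjC.
case: u v auv na => [i|j] [k|l] //= auv; rewrite !inE auv andbT negbK => /eqP <-.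
  by right.
by left.
Qed.

Lemma tree_ldeg F i : (0 < n)%N -> is_spanning_tree F -> (0 < ldeg F i)%N.
Proof.
move=> hn [_ cF]; have /connectP[[|[k|j] p] //= /andP[a _] _] := cF (inl i) (inr (Ordinal hn)).
by rewrite card_gt0; apply/set0Pn; exists j; rewrite inE.
Qed.

Lemma sum_ldeg F (P : pred 'I_m) :
  (\sum_(i | P i) ldeg F i)%N = #|[set e in F | P e.1]|.
Proof.
rewrite -sum1_card (partition_big (fun e => e.1) P) /=; last by move=> e; rewrite inE => /andP[].
apply: eq_bigr => i Pi; rewrite /ldeg -sum1_card.
rewrite (reindex_onto (fun j => (i, j)) (fun e => e.2)) /=; last first.
  by case=> a b /andP[_ /eqP/= ->].
by apply: eq_bigl => j; rewrite !inE /= !eqxx Pi !andbT.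
Qed.

Definition left_part (S : {set V}) : pred 'I_m := fun i => inl i \in S.
Definition right_part (S : {set V}) : pred 'I_n := fun j => inr j \in S.

Lemma card_left_right_part (S : {set V}) : #|S| = (#|left_part S| + #|right_part S|)%N.
Proof. by rewrite -sum1_card big_sumType /= !sum1_card. Qed.

(** Both sides of the cut carry a forest, and the two bounds of [forest_card_le]
add up to the number of edges of the tree, so both are equalities. *)
Lemma tree_cut_card F e : (0 < m)%N -> is_spanning_tree F -> e \in F ->
  (\sum_(i | left_part (cut F e) i) ldeg F i).+1 =
  (#|left_part (cut F e)| + #|right_part (cut F e)|)%N.
Proof.
move=> hm [FF cF] eF; rewrite sum_ldeg -card_left_right_part.
set A := [set f in F | _].
have cardF := tree_card hm (conj FF cF).
have hA : (#|A| < #|cut F e|)%N.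
  apply: (@forest_card_le _ _ (inr e.2)); rewrite ?cut_right //.
    by apply: sub_forest FF; apply/subsetP => f; rewrite inE => /andP[].
  move=> f; rewrite inE => /andP[fF]; rewrite /left_part /inside => fS; rewrite fS.
  rewrite -(cut_other fF) //; apply: contraTneq fS => ->; exact: cut_left.
have hB : (#|F :\ e :\: A| < #|~: cut F e|)%N.
  apply: (@forest_card_le _ _ (inl e.1)).
  - by apply: sub_forest FF; apply: subset_trans (subsetDl _ _) (subsetDl _ _).
  - by rewrite inE cut_left.
  - move=> f; rewrite ![f \in _]inE /left_part => /andP[+ /andP[fe fF]].
    by rewrite fF /inside ![_ \in ~: _]inE -(cut_other fF fe) andbb.
have sA : A \subset F :\ e.
  apply/subsetP => f; rewrite inE => /andP[fF fS]; rewrite !inE fF andbT.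
  apply: contraTneq fS => ->; exact: cut_left.
have := cardsC (cut F e); rewrite card_sum !card_ord -cardF => cC.
have := cardsID A (F :\ e); have /setIidPr -> := sA => cA.
apply/eqP; rewrite eqn_leq hA /= -(leq_add2r #|~: cut F e|) cC (cardsD1 e F) eF.
by rewrite add1n -cA -addSn -addnS leq_add2l.
Qed.

End Graphs.

(** * Transportation problems and flows on trees *)

Section Transport.
Variables (R : realType) (m n : nat).
Local Notation V := ('I_m + 'I_n)%type.
Local Notation E := ('I_m * 'I_n)%type.
Implicit Types (F T : {set E}) (e f : E) (u v : V) (S : {set V}) (x y w : E -> R).

Definition cut_sign S e : R := (inr e.2 \in S)%:R - (inl e.1 \in S)%:R.

Definition excess S x : R := \sum_e cut_sign S e * x e.

Lemma cut_signE S e : cut_sign S e = (inr e.2 \in S)%:R - (inl e.1 \in S)%:R.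
Proof. by []. Qed.

Lemma excessE S x : excess S x = \sum_e cut_sign S e * x e.
Proof. by []. Qed.

(** Quantifying over all vertex sets is equivalent to comparing the marginals at the
single vertices, and is the form in which the relation is applied to cuts. *)
Definition same_excess x y : Prop := forall S, excess S x = excess S y.

Definition supp_on F x : Prop := forall e, e \notin F -> x e = 0.

Definition left_marginal x i : R := \sum_j x (i, j).
Definition right_marginal x j : R := \sum_i x (i, j).

Lemma excessD S x y (t : R) : excess S (fun e => x e + t * y e) = excess S x + t * excess S y.
Proof.
rewrite /excess big_distrr -big_split /=; apply: eq_bigr => e _.
by rewrite mulrDr mulrCA.
Qed.

Lemma excessZ S y (t : R) : excess S (fun e => t * y e) = t * excess S y.
Proof. by rewrite /excess big_distrr; apply: eq_bigr => e _ /=; rewrite mulrCA. Qed.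

Lemma excess_sum (I : finType) S (c : I -> R) (y : I -> E -> R) :
  excess S (fun e => \sum_i c i * y i e) = \sum_i c i * excess S (y i).
Proof.
rewrite /excess (eq_bigr (fun e => \sum_i c i * (cut_sign S e * y i e))); last first.
  by move=> e _; rewrite big_distrr; apply: eq_bigr => i _ /=; rewrite mulrCA.
by rewrite exchange_big; apply: eq_bigr => i _ /=; rewrite big_distrr.
Qed.

Lemma excess_delta S e : excess S (fun f => (f == e)%:R) = cut_sign S e.
Proof.
rewrite /excess (bigD1 e) //= eqxx mulr1 big1 ?addr0 // => f fe.
by rewrite (negPf fe) mulr0.
Qed.

Lemma sum_edges (G : E -> R) : \sum_e G e = \sum_i \sum_j G (i, j).
Proof. by rewrite pair_bigA; apply: eq_bigr; case. Qed.

Lemma excess_marginals S x : excess S x =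
  \sum_(j | right_part S j) right_marginal x j - \sum_(i | left_part S i) left_marginal x i.
Proof.
rewrite /excess.
have -> : \sum_e cut_sign S e * x e =
   \sum_e (inr e.2 \in S)%:R * x e - \sum_e (inl e.1 \in S)%:R * x e.
  by rewrite -sumrB; apply: eq_bigr => e _; rewrite mulrBl.
congr (_ - _).
  rewrite sum_edges exchange_big.
  rewrite [RHS]big_mkcond; apply: eq_bigr => j _ /=; rewrite -big_distrr /=.
  by rewrite /right_part; case: ifP => _; rewrite ?mul1r ?mul0r.
rewrite sum_edges.
rewrite [RHS]big_mkcond; apply: eq_bigr => i _ /=; rewrite -big_distrr /=.
by rewrite /left_part; case: ifP => _; rewrite ?mul1r ?mul0r.
Qed.

Lemma excess_left x i : excess [set inl i] x = - left_marginal x i.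
Proof.
rewrite excess_marginals big_pred0 => [|j]; last by rewrite /right_part inE.
by rewrite (big_pred1 i) ?sub0r // => k; rewrite /left_part inE.
Qed.

Lemma excess_right x j : excess [set inr j] x = right_marginal x j.
Proof.
rewrite excess_marginals [X in _ - X]big_pred0 => [|i]; last by rewrite /left_part inE.
by rewrite (big_pred1 j) ?subr0 // => k; rewrite /right_part inE.
Qed.

Lemma same_excess_left x y i : same_excess x y -> left_marginal x i = left_marginal y i.
Proof. by move=> /(_ [set inl i]); rewrite !excess_left => /oppr_inj. Qed.

Lemma same_excess_right x y j : same_excess x y -> right_marginal x j = right_marginal y j.
Proof. by move=> /(_ [set inr j]); rewrite !excess_right. Qed.

Lemma same_excessP x y : left_marginal x =1 left_marginal y ->
  right_marginal x =1 right_marginal y -> same_excess x y.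
Proof.
by move=> r c S; rewrite !excess_marginals; congr (_ - _); apply: eq_bigr => k _; rewrite ?r ?c.
Qed.

Lemma excess_supp F x S : supp_on F x -> excess S x = \sum_(e in F) cut_sign S e * x e.
Proof.
move=> sx; rewrite /excess [RHS]big_mkcond; apply: eq_bigr => e _.
by case: ifPn => // /sx ->; rewrite mulr0.
Qed.

Lemma supp_sub F F' x : F \subset F' -> supp_on F x -> supp_on F' x.
Proof. by move=> /subsetP s sx e eF; apply: sx; apply: contra eF; apply: s. Qed.

(** Every edge of [F] other than [e] has both ends on the same side of the cut. *)
Lemma cut_sign_cut F e f : is_forest F -> e \in F -> f \in F ->
  cut_sign (cut F e) f = (f == e)%:R.
Proof.
move=> FF eF fF; rewrite /cut_sign; have [->|fe] := eqVneq f e.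
  by rewrite cut_right (negPf (cut_left FF eF)) subr0.
by rewrite (cut_other fF fe) subrr.
Qed.

Lemma flow_cut F w e : is_forest F -> supp_on F w -> e \in F ->
  excess (cut F e) w = w e.
Proof.
move=> FF sw eF; rewrite (excess_supp _ sw) (bigD1 e) //= cut_sign_cut // eqxx mul1r.
by rewrite big1 ?addr0 // => f /andP[fF fe]; rewrite cut_sign_cut // (negPf fe) mul0r.
Qed.

Lemma flow_unique F w w' : is_forest F -> supp_on F w -> supp_on F w' ->
  same_excess w w' -> w =1 w'.
Proof.
move=> FF sw sw' ww e; case: (boolP (e \in F)) => eF; last by rewrite sw ?sw'.
by rewrite -(flow_cut FF sw eF) -(flow_cut FF sw' eF).
Qed.

(** One unit is sent from [u] to [v] along a path; an edge traversed from right to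
left receives -1. *)
Lemma connect_flow F u v : connect (adj F) u v ->
  exists2 w, supp_on F w & forall S, excess S w = (v \in S)%:R - (u \in S)%:R.
Proof.
move=> /connectP[p pp ->]; elim: p u pp => [|a p IH] u /=.
  move=> _; exists (fun=> 0) => // S; rewrite subrr.
  by rewrite /excess big1 // => e _; rewrite mulr0.
move=> /andP[ua /IH[w sw hw]].
suff [w' sw' hw'] : exists2 w, supp_on F w & forall S, excess S w = (a \in S)%:R - (u \in S)%:R.
  exists (fun e => w e + 1 * w' e); first by move=> e eF; rewrite sw // sw' // mulr0 addr0.
  by move=> S; rewrite excessD hw hw' mul1r addrA subrK.
case: u a ua {sw hw w IH} => [i|j] [k|l] //= eF.
  exists (fun e => (e == (i, l))%:R); last by move=> S; rewrite excess_delta.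
  by move=> e; apply: contraNeq; rewrite pnatr_eq0 eqb0 negbK => /eqP ->.
exists (fun e => -1 * (e == (k, j))%:R); last by move=> S;
  rewrite excessZ excess_delta mulN1r opprB.
by move=> e; apply: contraNeq; rewrite mulN1r oppr_eq0 pnatr_eq0 eqb0 negbK => /eqP ->.
Qed.

Definition tree_flow T x : E -> R := fun e => if e \in T then excess (cut T e) x else 0.

Lemma tree_flow_supp T x : supp_on T (tree_flow T x).
Proof. by move=> e eT; rewrite /tree_flow (negPf eT). Qed.

Lemma tree_flow_unique F x w : is_forest F -> supp_on F w -> same_excess w x -> tree_flow F x =1 w.
Proof.
move=> FF sw wx e; rewrite /tree_flow; case: ifPn => eF; last by rewrite sw.
by rewrite -wx flow_cut.
Qed.

(** On a spanning tree every transportation problem has a solution with signed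
flow: each unit from [i] to [j] is rerouted along the tree. *)
Lemma tree_flow_same_excess T x : is_spanning_tree T -> same_excess (tree_flow T x) x.
Proof.
move=> [FT cT].
have : forall e, exists w, supp_on T w /\ forall S, excess S w = cut_sign S e.
  by move=> e; have [w sw hw] := connect_flow (cT (inl e.1) (inr e.2)); exists w.
move=> /choice[W WP].
pose w e := \sum_f x f * W f e.
have sw : supp_on T w.
  by move=> e eT; rewrite /w big1 // => f _; rewrite (WP f).1 ?mulr0.
have wx : same_excess w x.
  by move=> S; rewrite excess_sum; apply: eq_bigr => e _; rewrite (WP e).2 mulrC.
move=> S; rewrite -wx; apply: eq_bigr => e _; congr (_ * _).
exact: tree_flow_unique.
Qed.

Lemma excess_tree T x S : is_spanning_tree T ->
  excess S x = \sum_(f in T) cut_sign S f * excess (cut T f) x.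
Proof.
move=> tT; rewrite -(tree_flow_same_excess x tT) (excess_supp S (@tree_flow_supp T x)).
by apply: eq_bigr => f fT; rewrite /tree_flow fT.
Qed.

Definition nontriv S : bool := [exists e, cut_sign S e != 0].

Lemma cut_sign_eq0 S e : (cut_sign S e == 0) = ((inr e.2 \in S) == (inl e.1 \in S)).
Proof.
by rewrite /cut_sign; do 2 case: (_ \in _); rewrite ?subrr ?eqxx ?subr0 ?sub0r ?oppr_eq0 ?oner_eq0.
Qed.

(** The complete bipartite graph is connected, so a vertex set that is not
separated by any of its edges is empty or full. *)
Lemma trivial_cut S : (0 < m)%N -> (0 < n)%N -> ~~ nontriv S ->
  forall u v, (u \in S) = (v \in S).
Proof.
move=> hm hn; rewrite negb_exists => /forallP tr.
have tr' i j : (inr j \in S) = (inl i \in S).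
  by apply/eqP; rewrite -(cut_sign_eq0 S (i, j)); have := tr (i, j); rewrite negbK.
pose i0 := Ordinal hm; pose j0 := Ordinal hn.
case=> [i|j] [k|l]; rewrite ?tr' ?(tr' i0) // -?(tr' _ j0) //.
Qed.

Definition generic x : Prop := forall S, nontriv S -> excess S x != 0.

(** A connected component of [F] has excess 0 for any flow supported on [F]. *)
Lemma connected_of_generic F w x : (0 < m)%N -> (0 < n)%N -> generic x ->
  supp_on F w -> same_excess w x -> forall u v, connect (adj F) u v.
Proof.
move=> hm hn gx sw wx u v; pose S := [set v | connect (adj F) u v].
suff /trivial_cut tS : ~~ nontriv S.
  have : u \in S by rewrite inE connect0.
  by rewrite (tS hm hn u v) inE.
apply/negP => /gx; rewrite -wx (excess_supp S sw) big1 ?eqxx // => e eF.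
suff /eqP -> : cut_sign S e == 0 by rewrite mul0r.
rewrite cut_sign_eq0 !inE; apply/eqP; apply/idP/idP => c; apply: connect_trans c (connect1 _).
  by rewrite adjC adj_edge.
exact: adj_edge.
Qed.

(** The supply of each left vertex is divided equally among the right vertices, so
that all demands are equal to 1 when the total supply is [n]. *)
Definition spread (p : 'I_m -> R) : E -> R := fun e => p e.1 / n%:R.

Lemma left_marginal_spread p i : (0 < n)%N -> left_marginal (spread p) i = p i.
Proof.
move=> hn; rewrite /left_marginal /spread /= sumr_const card_ord -[LHS]mulr_natr divfK //.
by rewrite pnatr_eq0 -lt0n.
Qed.

Lemma right_marginal_spread p j : (0 < n)%N -> \sum_i p i = n%:R -> right_marginal (spread p) j = 1.
Proof.
move=> hn sp; rewrite /right_marginal /spread /= -big_distrl /= sp divff //.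
by rewrite pnatr_eq0 -lt0n.
Qed.

Lemma excess_spread p S : (0 < n)%N -> \sum_i p i = n%:R ->
  excess S (spread p) = #|right_part S|%:R - \sum_(i | left_part S i) p i.
Proof.
move=> hn sp; rewrite excess_marginals; congr (_ - _); last by apply: eq_bigr => i _;
  rewrite left_marginal_spread.
by under eq_bigr do rewrite right_marginal_spread //; rewrite sumr_const.
Qed.

(** By [tree_cut_card] a tree with left degrees [b + 1] has as many right vertices
in a cut as the sum of [b] over the cut, plus one; only [v] remains. *)
Lemma excess_spread_cut T e (b : 'rV[int]_m) (v : 'I_m -> R) : (0 < m)%N -> (0 < n)%N ->
  is_spanning_tree T -> e \in T -> LDminus T = b ->
  \sum_i ((b 0 i)%:~R + v i) = n%:R ->
  excess (cut T e) (spread (fun i => (b 0 i)%:~R + v i)) = 1 - \sum_(i | left_part (cut T e) i) v i.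
Proof.
move=> hm hn tT eT LD sv; rewrite excess_spread // big_split /=.
have : (\sum_(i | left_part (cut T e) i) ldeg T i).+1%:R =
  (#|left_part (cut T e)| + #|right_part (cut T e)|)%:R :> R.
  by rewrite tree_cut_card.
rewrite -natr1 natrD => eq1.
have -> : \sum_(i | left_part (cut T e) i) (b 0 i)%:~R =
  (\sum_(i | left_part (cut T e) i) ldeg T i)%:R - #|left_part (cut T e)|%:R :> R.
  rewrite natr_sum -sumr_const -sumrB; apply: eq_bigr => i _.
  by rewrite -LD mxE intrB.
lra.
Qed.

End Transport.

(** * Generic points and walks that cross one wall at a time *)

Section Generic.
Variables (R : realType) (m n : nat).
Local Notation V := ('I_m + 'I_n)%type.
Local Notation E := ('I_m * 'I_n)%type.
Implicit Types (F T : {set E}) (e f : E) (u v : V) (S : {set V}) (x y w z : E -> R).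
Local Notation cut_sign := (@cut_sign R m n).
Local Notation nontriv := (@nontriv R m n).

Lemma mul_pos_trans (a b c : R) : 0 < a * b -> 0 < b * c -> 0 < a * c.
Proof.
move=> ab bc; have b0 : b != 0 by apply: contraTneq ab => ->; rewrite mulr0 ltxx.
have : 0 < (a * c) * b ^+ 2 by rewrite expr2 mulrACA [c * b]mulrC mulr_gt0.
by rewrite pmulr_lgt0 // exprn_even_gt0.
Qed.

(** One positive bound works for finitely many affine functions of [t] that do not
vanish at 0. Here and below [0 < r * s] says that [r] and [s] have the same
nonzero sign. *)
Lemma small_eps (I : finType) (a c : I -> R) :
  exists2 d, 0 < d & forall t, 0 < t <= d -> forall i, a i != 0 -> 0 < a i * (a i + t * c i).
Proof.
suff [d d0 H] : exists2 d, 0 < d & forall t, 0 < t <= d -> forall i, i \in enum I ->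
    a i != 0 -> 0 < a i * (a i + t * c i).
  by exists d => // t td i; apply: H; rewrite ?mem_enum.
elim: (enum I) => [|i s [d d0 H]]; first by exists 1.
have [ai0|ai0] := eqVneq (a i) 0.
  exists d => // t td k; rewrite inE => /predU1P[->|]; last exact: H.
  by rewrite ai0 eqxx.
have na : 0 < `|a i| by rewrite normr_gt0.
have nc : 0 < `|c i| + 1 by rewrite ltr_wpDl.
exists (Num.min d (`|a i| / (`|c i| + 1))); first by rewrite lt_min d0 divr_gt0.
move=> t /andP[t0]; rewrite le_min => /andP[td tc] k.
rewrite inE => /predU1P[-> _|ks]; last by apply: H => //; rewrite t0.
have tc' : t * `|c i| < `|a i|.
  move: tc; rewrite ler_pdivlMr // mulrDr mulr1; apply: lt_le_trans.
  by rewrite ltrDl.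
rewrite mulrDr -expr2 -[a i ^+ 2]real_normK ?num_real //.
have : - (`|a i| * (t * `|c i|)) <= a i * (t * c i).
  rewrite lerNl; apply: le_trans (ler_norm _) _.
  by rewrite normrN !normrM (gtr0_norm t0).
have : `|a i| * (t * `|c i|) < `|a i| ^+ 2 by rewrite expr2 ltr_pM2l.
lra.
Qed.

Definition dot (l x : E -> R) : R := \sum_e l e * x e.

Lemma dotDdelta l x (t : R) e : dot l (fun f => x f + t * (f == e)%:R) = dot l x + t * l e.
Proof.
rewrite /dot (eq_bigr (fun f => l f * x f + t * (l f * (f == e)%:R))); last first.
  by move=> f _; rewrite mulrDr mulrCA.
rewrite big_split -big_distrr /= (bigD1 e) //= [in X in _ + X](bigD1 e) //= eqxx mulr1.
rewrite [X in _ + t * (_ + X)]big1 ?addr0 //; last by move=> f /negPf ->; rewrite mulr0.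
Qed.

(** The linear forms are treated one at a time: if a nonzero form vanishes at the
current point, a small increase of a single coordinate cures it and preserves
the signs already obtained. *)
Lemma perturbation (I : finType) (l : I -> E -> R) z : (forall e, 0 <= z e) ->
  exists x, [/\ forall e, 0 <= x e,
    forall i, (exists e, l i e != 0) -> dot (l i) x != 0 &
    forall i, dot (l i) z != 0 -> 0 < dot (l i) z * dot (l i) x].
Proof.
move=> z0.
suff [x [x0 xg xz]] : exists x, [/\ forall e, 0 <= x e,
    forall i, i \in enum I -> (exists e, l i e != 0) -> dot (l i) x != 0 &
    forall i, dot (l i) z != 0 -> 0 < dot (l i) z * dot (l i) x].
  by exists x; split=> // i; apply: xg; rewrite mem_enum.
elim: (enum I) => [|i s [x [x0 xg xz]]].
  by exists z; split=> // i zi; rewrite -expr2 exprn_even_gt0.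
have [xi|xi] := eqVneq (dot (l i) x) 0; last first.
  by exists x; split=> // k; rewrite inE => /predU1P[->//|]; apply: xg.
have [[e le]|ne] := pselect (exists e, l i e != 0); last first.
  by exists x; split=> // k; rewrite inE => /predU1P[->//|]; apply: xg.
have [d d0 H] := small_eps (fun k => dot (l k) x) (fun k => l k e).
exists (fun f => x f + d * (f == e)%:R); split.
- by move=> f; rewrite addr_ge0 // mulr_ge0 ?ler0n // ltW.
- move=> k; rewrite inE dotDdelta => /predU1P[-> _|ks ek].
    by rewrite xi add0r mulf_neq0 // gt_eqF.
  have := H d _ k (xg _ ks ek); rewrite d0 lexx => /(_ isT).
  by apply: contraTneq => ->; rewrite mulr0 ltxx.
- move=> k /xz zk; rewrite dotDdelta; apply: mul_pos_trans (zk) _.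
  apply: H; rewrite ?d0 ?lexx //.
  by apply: contraTneq zk => ->; rewrite mulr0 ltxx.
Qed.

(** The walls of [S] and [S'] are the same hyperplane when their forms agree up to
sign; the opposite sign occurs for complementary sets. *)
Definition same_wall S S' : bool :=
  [forall e, cut_sign S e == cut_sign S' e] || [forall e, cut_sign S e == - cut_sign S' e].

Lemma same_wallP S S' : same_wall S S' ->
  (forall x, excess S x = excess S' x) \/ (forall x, excess S x = - excess S' x).
Proof.
case/orP => /forallP H; [left|right] => x.
  by apply: eq_bigr => e _; rewrite (eqP (H e)).
by rewrite -sumrN; apply: eq_bigr => e _; rewrite (eqP (H e)) mulNr.
Qed.

Lemma cut_signP S e : [\/ cut_sign S e = 0, cut_sign S e = 1 | cut_sign S e = -1].
Proof.
by rewrite cut_signE; do 2 case: (_ \in _); rewrite ?subrr ?subr0 ?sub0r;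
  [apply: Or31|apply: Or32|apply: Or33|apply: Or31].
Qed.

(** Coefficients lie in {-1, 0, 1}, so two proportional forms of this kind are equal
or opposite. *)
Lemma cut_sign_indep S S' (a b : R) : nontriv S' -> ~~ same_wall S S' -> a != 0 ->
  exists e, a * cut_sign S' e - b * cut_sign S e != 0.
Proof.
move=> /existsP[e0 k0] ns a0; apply/existsP; apply: contraNT ns; rewrite negb_exists => /forallP H.
have H' e : a * cut_sign S' e = b * cut_sign S e by have := H e; rewrite negbK subr_eq0 => /eqP.
have ab : a = b \/ a = - b.
  have := H' e0; case: (cut_signP S' e0) k0 => -> k0; first by rewrite eqxx in k0.
    by case: (cut_signP S e0) => ->; rewrite ?mulr0 ?mulr1 ?mulrN1 => e; auto; rewrite e eqxx in a0.
  case: (cut_signP S e0) => ->; rewrite ?mulr0 ?mulr1 ?mulrN1 => e.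
  - by rewrite -oppr_eq0 e eqxx in a0.
  - by right; rewrite -e opprK.
  - by left; apply: oppr_inj.
apply/orP; case: ab => ab; [left|right]; apply/forallP => e; apply/eqP.
  by apply: (mulfI a0); rewrite H' ab.
by apply: (mulfI a0); rewrite mulrN H' ab mulNr.
Qed.

(** Along the segment from [x] to [y] the wall of [S] is met at the time
[excess S x / (excess S x - excess S y)]; the condition says that different
walls are met at different times. *)
Definition general_position x y : Prop := forall S S', nontriv S -> nontriv S' ->
  ~~ same_wall S S' ->
  excess S x * excess S' y != excess S' x * excess S y.

Lemma general_position_sym x y : general_position x y -> general_position y x.
Proof.
move=> g S S' tS tS' ns; have := g S S' tS tS' ns.
by rewrite eq_sym mulrC [X in _ != X]mulrC.
Qed.

Lemma dot_comb S S' x (a b : R) :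
  dot (fun e => a * cut_sign S' e - b * cut_sign S e) x = a * excess S' x - b * excess S x.
Proof.
rewrite /excess /dot ![_ * \sum_e _]big_distrr -sumrB /=.
by apply: eq_bigr => e _; rewrite mulrBl !mulrA.
Qed.

(** Genericity and general position with respect to a fixed generic point are both
the non-vanishing of finitely many nonzero linear forms. *)
Lemma generic_perturbation (J : finType) (X : J -> E -> R) z :
  (forall e, 0 <= z e) -> (forall j, generic (X j)) ->
  exists x, [/\ forall e, 0 <= x e, generic x, forall j, general_position (X j) x &
    forall S, excess S z != 0 -> 0 < excess S z * excess S x].
Proof.
move=> z0 gX.
pose l (i : {set V} + {set V} * {set V} * J) : E -> R :=
  match i with
  | inl A => cut_sign A
  | inr (A, B, j) => fun e => excess A (X j) * cut_sign B e - excess B (X j) * cut_sign A e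
  end.
have [x [x0 xg xz]] := perturbation l z0; exists x; split=> //.
- by move=> S /existsP tS; exact: (xg (inl S)).
- move=> j S S' tS tS' ns; have := xg (inr (S, S', j)) (cut_sign_indep _ tS' ns (gX j S tS)).
  by rewrite /= dot_comb subr_eq0.
- by move=> S; exact: (xz (inl S)).
Qed.

Definition same_side x y : Prop := forall S, nontriv S -> 0 < excess S x * excess S y.

(** One step from [x] to [x'] through the wall of [S0] alone; [xs] is the point of
the wall at which the step crosses it. *)
Record crossing x xs x' S0 : Prop := Crossing {
  crossing_wall : excess S0 xs = 0;
  crossing_sides : excess S0 x * excess S0 x' < 0;
  crossing_others : forall S, nontriv S -> ~~ same_wall S S0 ->
    0 < excess S x * excess S xs /\ 0 < excess S x * excess S x';
  crossing_ge0 : forall e, 0 <= x' e }.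

Definition separating x y : {set {set V}} := [set S | excess S x * excess S y < 0].

Lemma same_wall_separating x y S S' : same_wall S S' ->
  (S \in separating x y) = (S' \in separating x y).
Proof. by move=> /same_wallP[] H; rewrite !inE !H // mulrNN. Qed.

Lemma trivial_excess S x : ~~ nontriv S -> excess S x = 0.
Proof.
rewrite negb_exists => /forallP H; rewrite /excess big1 // => e _.
by have := H e; rewrite negbK => /eqP ->; rewrite mul0r.
Qed.

(** The wall met first is the one with the smallest crossing time; the next point
is taken on the segment shortly after that time, before any other wall. *)
Lemma first_crossing x0 x1 : (forall e, 0 <= x0 e) -> (forall e, 0 <= x1 e) ->
  generic x0 -> generic x1 -> general_position x0 x1 -> separating x0 x1 != finset.set0 ->
  exists S0 xs x', [/\ crossing x0 xs x' S0, S0 \in separating x0 x1, generic x',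
     general_position x' x1 & separating x' x1 \proper separating x0 x1].
Proof.
move=> p0 p1 g0 g1 gp /set0Pn[S1 S1s].
pose t S := excess S x0 / (excess S x0 - excess S x1).
case: (@arg_minP _ _ _ S1 (mem (separating x0 x1)) t S1s) => S0 S0s' tmin.
have S0s : S0 \in separating x0 x1 := S0s'; clear S0s'.
have key S : S \in separating x0 x1 -> [/\ excess S x0 != 0, excess S x0 - excess S x1 != 0 &
  0 < t S < 1].
  rewrite inE => neg.
  have a0 : excess S x0 != 0 by apply: contraTneq neg => ->; rewrite mul0r ltxx.
  have aa : 0 < excess S x0 ^+ 2 by rewrite exprn_even_gt0.
  have den : excess S x0 - excess S x1 != 0.
    apply: contraTneq neg => /eqP; rewrite subr_eq0 => /eqP <-.
    by rewrite -expr2 -leNgt ltW.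
  have tE : t S = excess S x0 ^+ 2 / (excess S x0 ^+ 2 - excess S x0 * excess S x1).
    by rewrite /t expr2 -mulrBr -mulf_div divff // mul1r.
  split=> //; rewrite tE divr_gt0 //=; last by lra.
  by rewrite ltr_pdivrMr; lra.
set ts := t S0 in tmin.
have [a0 d0 /andP[ts0 ts1]] := key _ S0s; rewrite -/ts in ts0 ts1.
(* The direction of the segment is written so that [excessD] applies to it. *)
pose D e := x1 e + (-1) * x0 e.
pose xs e := x0 e + ts * D e.
have hDD S : excess S D = excess S x1 - excess S x0 by rewrite /D excessD mulN1r.
have hxs S : excess S xs = excess S x0 + ts * (excess S x1 - excess S x0)
  by rewrite /xs excessD hDD.
have [d dgt0 Hd] := small_eps (fun S => excess S xs) (fun S => excess S D).
(* Halving keeps the new point strictly before the end [x1] of the segment. *)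
pose t' := Num.min d ((1 - ts) / 2).
have t'0 : 0 < t' by rewrite lt_min dgt0 divr_gt0 // subr_gt0.
have t'd : 0 < t' <= d by rewrite t'0 ge_min lexx.
have t'1 : ts + t' < 1.
  have : t' <= (1 - ts) / 2 by rewrite ge_min lexx orbT.
  by lra.
pose x' e := xs e + t' * D e.
have hx' S : excess S x' = excess S xs + t' * (excess S x1 - excess S x0)
  by rewrite /x' excessD hDD.
have hx's S : excess S x' = (1 - (ts + t')) * excess S x0 + (ts + t') * excess S x1.
  by rewrite hx' hxs; lra.
have hS0 : excess S0 xs = 0.
  by rewrite hxs -[excess S0 x1 - _]opprB mulrN /ts /t divfK // subrr.
have simS0 S : same_wall S S0 -> excess S xs = 0.
  by move=> /same_wallP[] ->; rewrite hS0 ?oppr0.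
have side S : nontriv S -> ~~ same_wall S S0 -> 0 < excess S x0 * excess S xs.
  move=> tS ns; rewrite hxs.
  have := g0 S tS; have := g1 S tS; have := gp S S0 tS _ ns.
  set a := excess S x0; set b := excess S x1 => gpS b0 aN0.
  have aa : 0 < a ^+ 2 by rewrite exprn_even_gt0.
  have -> : a * (a + ts * (b - a)) = a ^+ 2 - ts * (a ^+ 2 - a * b).
    by rewrite expr2 mulrDr mulrCA mulrBr -[a * b - _]opprB mulrN.
  have [neg|pos] := ltP (a * b) 0; last first.
    have : 0 < (1 - ts) * a ^+ 2 by rewrite mulr_gt0 // subr_gt0.
    have : 0 <= ts * (a * b) by rewrite mulr_ge0 // ltW.
    lra.
  have Ss : S \in separating x0 x1 by rewrite inE.
  have [_ dS _] := key S Ss.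
  have le : ts <= t S by apply: tmin.
  have tN : ts != t S.
    apply/eqP => tt; have := gpS _; rewrite (_ : nontriv S0).
      move=> /(_ isT) /eqP; apply.
      have eS0 : ts * (excess S0 x0 - excess S0 x1) = excess S0 x0 by rewrite divfK.
      have eS : ts * (a - b) = a by rewrite tt divfK.
      have tsN0 : ts != 0 by rewrite gt_eqF.
      apply: (mulfI tsN0).
      have -> : ts * (a * excess S0 x1) = a * (ts * excess S0 x0 - excess S0 x0)
        by rewrite -[X in _ - X]eS0; ring.
      have -> : ts * (excess S0 x0 * b) = excess S0 x0 * (ts * a - a) by rewrite -[X in _ - X]eS;
        ring.
      ring.
    by apply: contraNT d0 => /trivial_excess H; rewrite !H subrr.
  have tlt : ts < t S by rewrite lt_neqAle tN.
  have D0 : 0 < a ^+ 2 - a * b by lra.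
  have tE : t S = a ^+ 2 / (a ^+ 2 - a * b).
    have aN : a != 0 by [].
    by rewrite /t -/a -/b expr2 -mulrBr -mulf_div divff // mul1r.
  by rewrite subr_gt0 -ltr_pdivlMr // -tE.
have side' S : nontriv S -> ~~ same_wall S S0 -> 0 < excess S x0 * excess S x'.
  move=> tS ns; have := side S tS ns => s1; apply: mul_pos_trans (s1) _.
  rewrite hx' -hDD; apply: Hd => //.
  by apply: contraTneq s1 => ->; rewrite mulr0 ltxx.
have simx' S : same_wall S S0 -> excess S x' = t' * (excess S x1 - excess S x0).
  by move=> /simS0 e; rewrite hx' e add0r.
exists S0, xs, x'; split=> //.
- split=> //.
  + move: S0s; rewrite inE simx' ?/same_wall; last by apply/orP; left; apply/forallP.
    move=> neg; rewrite mulrCA pmulr_rlt0 // mulrBr.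
    have : 0 <= excess S0 x0 * excess S0 x0 by rewrite -expr2 sqr_ge0.
    lra.
  + by move=> S tS ns; split; [exact: side|exact: side'].
  + move=> e; have -> : x' e = (1 - (ts + t')) * x0 e + (ts + t') * x1 e.
      by rewrite /x' /xs /D; ring.
    by rewrite addr_ge0 // mulr_ge0 // ?subr_ge0 ltW // addr_gt0.
- move=> S tS; have [sS|nS] := boolP (same_wall S S0).
    rewrite simx' // mulf_neq0 ?(gt_eqF t'0) //.
    have : S \in separating x0 x1 by rewrite (same_wall_separating _ _ sS).
    by move=> /key[_ dS _]; rewrite -opprB oppr_eq0.
  by apply: contraTneq (side' S tS nS) => ->; rewrite mulr0 ltxx.
- move=> S S' tS tS' ns; rewrite !hx's -subr_eq0.
  rewrite (_ : _ - _ = (1 - (ts + t')) * (excess S x0 * excess S' x1 - excess S' x0 * excess S x1)); last by ring.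
  by rewrite mulf_neq0 ?subr_eq0 ?gp // eq_sym lt_eqF.
- apply/fintype.properP; split.
    apply/fintype.subsetP => S; rewrite ![S \in _]inE => neg.
    have [sS|nS] := boolP (same_wall S S0).
      by have := same_wall_separating x0 x1 sS; rewrite S0s inE.
    have tS : nontriv S by apply: contraLR neg => /trivial_excess H; rewrite !H mul0r ltxx.
    have := side' S tS nS => pos; rewrite ltNge; apply/negP => ge.
    have : 0 < excess S x0 * excess S x1 by rewrite lt_neqAle ge andbT eq_sym mulf_neq0 ?g0 ?g1.
    rewrite mulrC => pos2; have := mul_pos_trans pos2 pos; rewrite mulrC.
    by move: neg; lra.
  exists S0 => //; rewrite inE simx'; last by apply/orP; left; apply/forallP.
  move: S0s; rewrite inE => neg; rewrite -leNgt -mulrA mulr_ge0 ?ltW // mulrBl.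
  have : 0 <= excess S0 x1 * excess S0 x1 by rewrite -expr2 sqr_ge0.
  lra.
Qed.

(** Induction on the number of cuts that separate the current point from the goal.
The hypothesis on [Q] restricts the walls that can be crossed, which is what
allows walks to remain near a given point. *)
Lemma walk (P : (E -> R) -> Prop) (Q : {set V} -> Prop) :
  (forall x y, same_side x y -> P x -> P y) ->
  (forall x xs x' S, crossing x xs x' S -> Q S -> P x -> P x') ->
  forall x0 x1, (forall e, 0 <= x0 e) -> (forall e, 0 <= x1 e) ->
  generic x0 -> generic x1 -> general_position x0 x1 ->
  (forall S, S \in separating x0 x1 -> Q S) -> P x0 -> P x1.
Proof.
move=> Ps Pc x0 x1; have [N] := ubnP #|separating x0 x1|.
elim: N => // N IH in x0 *; rewrite ltnS => leN p0 p1 g0 g1 gp sQ.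
have [sep0|sepN] := eqVneq (separating x0 x1) finset.set0.
  apply: Ps => S tS; have : S \notin separating x0 x1 by rewrite sep0 inE.
  by rewrite inE -leNgt lt_neqAle eq_sym => ->; rewrite mulf_neq0 ?g0 ?g1.
have [S0 [xs [x' [c S0s g' gp' pr]]]] := first_crossing p0 p1 g0 g1 gp sepN.
move=> P0; apply: (IH x') => //.
- exact: leq_trans (proper_card pr) leN.
- exact: crossing_ge0 c.
- by move=> S Ss; apply: sQ; apply: (fintype.subsetP (proper_sub pr)).
- exact: Pc c (sQ _ S0s) P0.
Qed.

End Generic.

(** * Lattice points and left degree vectors *)

Section LatticeVectors.
Variable m : nat.
Implicit Types a b : 'rV[int]_m.
Local Notation e_ := (@unit_vec m).

Lemma lattice_simplexP k b : reflect ((forall i, 0 <= b 0 i) /\ \sum_i b 0 i = k)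
  (b \in lattice_simplex m k).
Proof.
apply: (iffP andP) => -[H /eqP s]; split=> //; first exact/forallP.
exact/forallP.
Qed.

Lemma unit_vecE i k : e_ i 0 k = (k == i)%:R.
Proof. by rewrite mxE. Qed.

Lemma addvE a i k : (a + e_ i) 0 k = a 0 k + (k == i)%:R.
Proof. by rewrite mxE unit_vecE. Qed.

Lemma subvE a i k : (a - e_ i) 0 k = a 0 k - (k == i)%:R.
Proof. by rewrite !mxE. Qed.

Lemma subvvE a b k : (a - b) 0 k = a 0 k - b 0 k.
Proof. by rewrite !mxE. Qed.

Lemma sum_unit_vec (P : pred 'I_m) i : \sum_(k | P k) e_ i 0 k = (P i)%:R.
Proof.
rewrite big_mkcond (bigD1 i) //= big1 ?addr0.
  by rewrite unit_vecE eqxx; case: (P i).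
by move=> k /negPf ki; rewrite unit_vecE ki; case: ifP.
Qed.

Lemma unit_vec_inj : injective e_.
Proof.
by move=> i k /matrixP/(_ 0 i); rewrite !unit_vecE eqxx; case: eqVneq.
Qed.

Lemma lattice_simplexD k b i : b \in lattice_simplex m k -> b + e_ i \in lattice_simplex m (k + 1).
Proof.
move=> /lattice_simplexP[b0 sb]; apply/lattice_simplexP; split=> [l|].
  by rewrite mxE unit_vecE addr_ge0 ?ler0n.
under eq_bigr do rewrite mxE.
by rewrite big_split /= sb sum_unit_vec.
Qed.

Lemma lattice_simplexB k a i : a \in lattice_simplex m k ->
  (a - e_ i \in lattice_simplex m (k - 1)) = (0 < a 0 i).
Proof.
move=> /lattice_simplexP[a0 sa]; apply/lattice_simplexP/idP => [[/(_ i)]|ai].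
  by rewrite subvE eqxx; lia.
split=> [l|].
  rewrite subvE; have := a0 l; case: eqVneq => [->|_]; lia.
under eq_bigr do rewrite subvE -unit_vecE.
by rewrite sumrB sa sum_unit_vec.
Qed.

Lemma LDminusE n (F : {set 'I_m * 'I_n}) i : LDminus F 0 i = (ldeg F i)%:Z - 1.
Proof. by rewrite mxE. Qed.

Lemma sum_LDminus n (F : {set 'I_m * 'I_n}) : \sum_i LDminus F 0 i = #|F|%:Z - m%:Z.
Proof.
under eq_bigr do rewrite LDminusE.
rewrite sumrB sumr_const card_ord -[LHS]/(_ - _) -(big_morph _ PoszD (erefl 0%:Z)) sum_ldeg.
have -> : #|[set e in F | xpredT e.1]| = #|F| by apply: eq_card => e; rewrite inE andbT.
lia.
Qed.

End LatticeVectors.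

(** * The barycentre attached to a lattice point *)

Section Barycentres.
Variables (R : realType) (m n : nat).
Hypotheses (hm : (0 < m)%N) (hn : (0 < n)%N).
Local Notation V := ('I_m + 'I_n)%type.
Local Notation E := ('I_m * 'I_n)%type.
Implicit Types (F T : {set E}) (e f : E) (S : {set V}) (x y w z : E -> R) (b : 'rV[int]_m).
Local Notation excess := (@excess R m n).
Local Notation nontriv := (@nontriv R m n).

Lemma lattice_point : exists b : 'rV[int]_m, b \in lattice_simplex m (n%:Z - 1).
Proof.
exists ((n%:Z - 1) *: unit_vec (Ordinal hm)); apply/lattice_simplexP; split=> [i|].
  by rewrite mxE unit_vecE; case: eqP => _; rewrite ?mulr1 ?mulr0 //; lia.
under eq_bigr do rewrite mxE.
by rewrite -big_distrr /= sum_unit_vec mulr1.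
Qed.

(** The mean of the points of contents [b + e_k], with all demands equal to 1. *)
Definition barycentre b : E -> R := spread (fun i => (b 0 i)%:~R + m%:R^-1).

Lemma natr_m_neq0 : m%:R != 0 :> R. Proof. by rewrite pnatr_eq0 -lt0n. Qed.

Lemma sum_barycentre b : b \in lattice_simplex m (n%:Z - 1) ->
  \sum_i ((b 0 i)%:~R + m%:R^-1) = n%:R :> R.
Proof.
move=> /lattice_simplexP[_ sb]; rewrite big_split -(raddf_sum intr) /= sb sumr_const card_ord.
by rewrite -[m%:R^-1 *+ m]mulr_natr mulVf ?natr_m_neq0 // intrB subrK.
Qed.

Lemma barycentre_ge0 b e : b \in lattice_simplex m (n%:Z - 1) -> 0 <= barycentre b e.
Proof.
move=> /lattice_simplexP[b0 _]; rewrite /barycentre /spread divr_ge0 ?ler0n // addr_ge0 ?ler0z //.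
by rewrite invr_ge0 ler0n.
Qed.

(** An excess of the barycentre is an integer minus a multiple of [1/m] by the number
of left vertices in the set, so if it vanishes this number is 0 or [m]. *)
Lemma barycentre_generic b : b \in lattice_simplex m (n%:Z - 1) -> generic (barycentre b).
Proof.
move=> bL S /existsP[e]; rewrite cut_sign_eq0; apply: contraNneq.
rewrite /barycentre excess_spread ?sum_barycentre // big_split /= sumr_const -(raddf_sum intr) /=.
move: bL => /lattice_simplexP[b0 sb].
set s := \sum_(i | _) _; set A := #|left_part S|; set B := #|right_part S| => e0.
have e1 : m%:Z * (B%:Z - s) = A%:Z.
  apply: (@intr_inj R); rewrite intrM intrB -!pmulrn.
  have : m%:R * (B%:R - (s%:~R + m%:R^-1 *+ A)) = 0 :> R by rewrite e0 mulr0.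
  rewrite -[m%:R^-1 *+ A]mulr_natr => e2; have : m%:R * (m%:R^-1 * A%:R) = A%:R :> R.
    by rewrite mulrA divff ?mul1r ?natr_m_neq0.
  by lra.
have Am : (A <= m)%N by rewrite -[X in (_ <= X)%N](card_ord m) max_card.
(* By [e1], [A] is a multiple of [m], and it is at most [m]. *)
have [BsA|BsA] : (B%:Z - s = 0 /\ A = 0%N) \/ (B%:Z - s = 1 /\ A = m).
- move: (B%:Z - s) e1 hm Am => d e1 hm' Am.
  have d0 : 0 <= d by nia.
  have d1 : d <= 1 by nia.
  have [d00|d11] : d = 0 \/ d = 1 by lia.
    by left; split=> //; rewrite d00 in e1; lia.
  by right; split=> //; rewrite d11 in e1; lia.
- case: BsA => Bs A0.
  have L0 i : inl i \in S = false by have := card0_eq A0 i; rewrite !inE.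
  have s0 : s = 0 by rewrite /s big_pred0 // => i; rewrite /left_part L0.
  have B0 : B = 0%N by lia.
  have R0 j : inr j \in S = false by have := card0_eq B0 j; rewrite !inE.
  by rewrite L0 R0.
- case: BsA => Bs A1.
  have L1 i : inl i \in S.
    have /subset_cardP : #|left_part S| = #|'I_m| by rewrite card_ord.
    by move=> /(_ (fintype.subset_predT _)) /(_ i); rewrite !inE.
  have s1 : s = n%:Z - 1 by rewrite -sb; apply: eq_bigl => i; rewrite /left_part L1.
  have B1 : B = n by lia.
  have R1 j : inr j \in S.
    have /subset_cardP : #|right_part S| = #|'I_n| by rewrite card_ord.
    by move=> /(_ (fintype.subset_predT _)) /(_ j); rewrite !inE.
  by rewrite L1 R1.
Qed.

(** Moving from [z] slightly towards a barycentre makes it generic without changing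
the sign of any nonzero excess. *)
Lemma nearby_generic b z : b \in lattice_simplex m (n%:Z - 1) -> (forall e, 0 <= z e) ->
  exists x, [/\ forall e, 0 <= x e, generic x,
    forall S, excess S z != 0 -> 0 < excess S z * excess S x &
    exists2 d, 0 < d & forall e, x e = z e + d * barycentre b e].
Proof.
move=> bL z0; have [d d0 Hd] := small_eps (fun S => excess S z) (fun S => excess S (barycentre b)).
pose x e := z e + d * barycentre b e.
have hx S : excess S x = excess S z + d * excess S (barycentre b) by rewrite excessD.
have side S : excess S z != 0 -> 0 < excess S z * excess S x.
  by move=> zS; rewrite hx; apply: Hd; rewrite ?d0 ?lexx.
exists x; split=> //; last by exists d.
  by move=> e; rewrite addr_ge0 // mulr_ge0 ?barycentre_ge0 // ltW.
move=> S tS; have [zS|zS] := eqVneq (excess S z) 0.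
  by rewrite hx zS add0r mulf_neq0 ?(gt_eqF d0) ?barycentre_generic.
by apply: contraTneq (side S zS) => ->; rewrite mulr0 ltxx.
Qed.

(** The flow through an edge is 1 minus [1/m] times the number of left vertices in
its cut, and the left end of the edge is not in the cut. *)
Lemma barycentre_cut T b e : b \in lattice_simplex m (n%:Z - 1) -> is_spanning_tree T ->
  LDminus T = b -> e \in T -> 0 < excess (cut T e) (barycentre b).
Proof.
move=> bL tT LD eT; rewrite /barycentre excess_spread_cut // ?sum_barycentre // sumr_const subr_gt0.
rewrite -[_ *+ _]mulr_natl ltr_pdivrMr ?mul1r ?ltr0n // ltr_nat.
rewrite -[X in (_ < X)%N](card_ord m) (cardD1 e.1 'I_m) inE add1n ltnS.
apply: subset_leq_card; apply/fintype.subsetP => i; rewrite !inE andbT => iA.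
by apply: contraTneq iA => ->; apply: cut_left; case: tT.
Qed.

Lemma left_marginal_barycentre b i : left_marginal (barycentre b) i = (b 0 i)%:~R + m%:R^-1.
Proof. by rewrite /barycentre left_marginal_spread. Qed.

Lemma right_marginal_barycentre b j : b \in lattice_simplex m (n%:Z - 1) ->
  right_marginal (barycentre b) j = 1.
Proof. by move=> bL; rewrite /barycentre right_marginal_spread // sum_barycentre. Qed.

(** All demands are 1, so the flow is at most 1 on each edge and the degree of [i]
is at least its supply [b_i + 1/m], hence at least [b_i + 1]. The number of
edges of a tree leaves no room for a larger degree. *)
Lemma barycentre_degree F w b : b \in lattice_simplex m (n%:Z - 1) ->
  is_spanning_tree F -> supp_on F w -> (forall e, 0 <= w e) -> same_excess w (barycentre b) ->
  LDminus F = b.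
Proof.
move=> bL tF sw w0 wy.
have w1 e : w e <= 1.
  have := same_excess_right e.2 wy;
    rewrite right_marginal_barycentre // /right_marginal (bigD1 e.1) //= -surjective_pairing => <-.
  by rewrite lerDl sumr_ge0.
have deg i : b 0 i + 1 <= (ldeg F i)%:Z.
  have : (b 0 i)%:~R < (ldeg F i)%:~R :> R.
    have := same_excess_left i wy; rewrite left_marginal_barycentre => e1.
    have : left_marginal w i <= (ldeg F i)%:R.
      rewrite /left_marginal /ldeg -sum1_card natr_sum [leRHS]big_mkcond /=; apply: ler_sum => j _.
      by rewrite inE; case: ifPn => // /sw ->.
    rewrite -pmulrn e1; apply: lt_le_trans; rewrite ltrDl invr_gt0 ltr0n //.
  by rewrite ltr_int; lia.
have : \sum_i ((ldeg F i)%:Z - 1 - b 0 i) = 0.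
  rewrite sumrB; move: bL => /lattice_simplexP[_ ->].
  under eq_bigr do rewrite -LDminusE.
  rewrite sum_LDminus; have := tree_card hm tF; lia.
move=> /eqP; rewrite psumr_eq0 => [/allP H|i _]; last by have := deg i; lia.
apply/rowP => i; rewrite mxE; have := H i; rewrite mem_index_enum => /(_ isT) /=.
lia.
Qed.

Lemma LDminus_lattice T : is_spanning_tree T -> LDminus T \in lattice_simplex m (n%:Z - 1).
Proof.
move=> tT; apply/lattice_simplexP; split.
  by move=> i; rewrite mxE; have := tree_ldeg i hn tT; lia.
by rewrite sum_LDminus; have := tree_card hm tT; lia.
Qed.

End Barycentres.

(** * Simplices as cones of flows *)

Section Hulls.
Variables (R : realType) (m n : nat).
Local Notation V := ('I_m + 'I_n)%type.
Local Notation E := ('I_m * 'I_n)%type.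
Implicit Types (F T : {set E}) (e f : E) (S : {set V}) (x y w z : E ->
  R) (tau : set (set 'rV[R]_(m + n))).
Local Notation hull := (@root_hull R m n).

Definition point_of x : 'rV[R]_(m + n) := \sum_e x e *: root_point R e.

Lemma point_of_left x i : point_of x 0 (lshift n i) = left_marginal x i.
Proof.
rewrite /point_of summxE sum_edges /left_marginal (bigD1 i) //= [X in _ + X]big1 ?addr0.
  apply: eq_bigr => j _; rewrite !mxE !eqxx /= eq_lrshift.
  by rewrite subr0 mulr1.
move=> k ki; rewrite big1 // => j _; rewrite !mxE !eqxx /= eq_lrshift eq_lshift.
by rewrite eq_sym (negPf ki) subr0 mulr0.
Qed.

Lemma point_of_right x j : point_of x 0 (rshift m j) = - right_marginal x j.
Proof.
rewrite /point_of summxE sum_edges exchange_big /= (bigD1 j) //= [X in _ + X]big1 ?addr0.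
  rewrite /right_marginal -sumrN; apply: eq_bigr => i _; rewrite !mxE !eqxx /= eq_rlshift.
  by rewrite sub0r mulrN1.
move=> k kj; rewrite big1 // => i _; rewrite !mxE !eqxx /= eq_rlshift eq_rshift.
by rewrite eq_sym (negPf kj) subr0 mulr0.
Qed.

Lemma point_of_eq x y : point_of x = point_of y <-> same_excess x y.
Proof.
split=> [e|xy].
  apply: same_excessP => [i|j]; first by rewrite -!point_of_left e.
  by apply: oppr_inj; rewrite -!point_of_right e.
apply/rowP => k; rewrite -(splitK k); case: (split k) => [i|j] /=.
  by rewrite !point_of_left (same_excess_left i xy).
by rewrite !point_of_right (same_excess_right j xy).
Qed.

Lemma same_excess_sum x y : same_excess x y -> \sum_e x e = \sum_e y e.
Proof.
by move=> xy; rewrite !sum_edges; apply: eq_bigr => i _; exact: same_excess_left.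
Qed.

Lemma hullP F (q : 'rV[R]_(m + n)) : hull F q <->
  exists w, [/\ supp_on F w, forall e, 0 <= w e, \sum_e w e = 1 & q = point_of w].
Proof.
split=> [[w [w0 w1 ->]]|[w [sw w0 w1 ->]]].
  exists (fun e => if e \in F then w e else 0); split.
  - by move=> e /negPf ->.
  - by move=> e; case: ifP => // /w0.
  - by rewrite -w1 [RHS]big_mkcond.
  - by rewrite /point_of big_mkcond; apply: eq_bigr => e _; case: ifP => //; rewrite scale0r.
exists w; split=> //.
- rewrite -w1 [LHS]big_mkcond; apply: eq_bigr => e _; case: ifPn => //.
  by move/sw.
- rewrite /point_of [RHS]big_mkcond; apply: eq_bigr => e _; case: ifPn => //.
  by move/sw ->; rewrite scale0r.
Qed.

Lemma hull_sub F F' : F \subset F' -> (hull F `<=` hull F')%classic.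
Proof.
move=> s q /hullP[w [sw w0 w1 ->]]; apply/hullP; exists w; split=> //.
exact: supp_sub sw.
Qed.

(** A root point has a single nonzero supply and a single nonzero demand, so no other
root point can contribute to a convex combination equal to it. *)
Lemma root_point_hull e F : hull F (root_point R e) -> e \in F.
Proof.
have -> : root_point R e = point_of (fun f => (f == e)%:R).
  rewrite /point_of (bigD1 e) //= eqxx scale1r big1 ?addr0 // => f /negPf ->.
  by rewrite scale0r.
move=> /hullP[w [sw w0 w1]] /point_of_eq ew; apply/negPn/negP => /sw we.
have rw i : i != e.1 -> left_marginal w i = 0.
  move=> ie; rewrite -(same_excess_left i ew) /left_marginal big1 // => j _.
  by case: e ie {sw we ew} => a b /= /negPf ie; rewrite xpair_eqE ie.
have cw j : j != e.2 -> right_marginal w j = 0.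
  move=> je; rewrite -(same_excess_right j ew) /right_marginal big1 // => i _.
  by case: e je {sw we ew rw} => a b /= /negPf je; rewrite xpair_eqE je andbF.
have w00 f : w f = 0.
  have [f1|f1] := eqVneq f.1 e.1; last first.
    have /eqP := rw _ f1; rewrite psumr_eq0 // => /allP/(_ f.2).
    by rewrite mem_index_enum -surjective_pairing => /(_ isT)/eqP.
  have [f2|f2] := eqVneq f.2 e.2; last first.
    have /eqP := cw _ f2; rewrite psumr_eq0 // => /allP/(_ f.1).
    by rewrite mem_index_enum -surjective_pairing => /(_ isT)/eqP.
  by rewrite [f]surjective_pairing f1 f2 -surjective_pairing.
by move: w1; rewrite big1 // => /eqP; rewrite eq_sym oner_eq0.
Qed.

Lemma hull_root_point e F : e \in F -> hull F (root_point R e).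
Proof.
move=> eF; exists (fun f => (f == e)%:R); split.
- by move=> f _; rewrite ler0n.
- by rewrite (bigD1 e) //= eqxx big1 ?addr0 // => f /andP[_ /negPf ->].
- by rewrite (bigD1 e) //= eqxx scale1r big1 ?addr0 // => f /andP[_ /negPf ->]; rewrite scale0r.
Qed.

Lemma hull_inj : injective hull.
Proof.
move=> F F' e; apply/setP => f; apply/idP/idP => /hull_root_point.
  by rewrite e => /root_point_hull.
by rewrite -e => /root_point_hull.
Qed.

(** The cone over the simplex of [F]; working with it avoids normalizing sums to 1. *)
Definition cone F x : Prop :=
  exists w, [/\ supp_on F w, forall e, 0 <= w e & same_excess w x].

Lemma same_excessZ x y (t : R) : same_excess x y ->
  same_excess (fun e => t * x e) (fun e => t * y e).
Proof. by move=> xy S; rewrite !excessZ xy. Qed.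

Lemma tri_cover tau x : is_triangulation tau -> (forall e, 0 <= x e) -> 0 < \sum_e x e ->
  exists F, [/\ is_forest F, tau (hull F) & cone F x].
Proof.
move=> [H1 _ _ H4] x0 sx; set s := \sum_e x e in sx.
have : @root_polytope R m n (point_of (fun e => s^-1 * x e)).
  apply/hullP; exists (fun e => s^-1 * x e); split=> //.
  - by move=> e; rewrite finset.in_setT.
  - by move=> e; rewrite mulr_ge0 // invr_ge0 ltW.
  - by rewrite -big_distrr /= mulVf // gt_eqF.
rewrite -H4 => -[s0 ts]; have [F [FF es]] := H1 _ ts; rewrite {}es in ts *.
move=> /hullP[w [sw w0 w1 /point_of_eq ew]]; exists F; split=> //.
exists (fun e => s * w e); split.
- by move=> e /sw ->; rewrite mulr0.
- by move=> e; rewrite mulr_ge0 // ltW.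
- by move=> S; rewrite excessZ -ew excessZ mulrA divff ?mul1r // gt_eqF.
Qed.

(** The common point lies over [F :&: F'], and the flow there coincides with both
flows because [F] and [F'] are forests. *)
Lemma tri_unique tau F F' w w' : is_triangulation tau ->
  is_forest F -> is_forest F' -> tau (hull F) -> tau (hull F') ->
  supp_on F w -> supp_on F' w' -> (forall e, 0 <= w e) -> (forall e, 0 <= w' e) ->
  same_excess w w' -> w =1 w'.
Proof.
move=> [_ _ H3 _] FF FF' tF tF' sw sw' w0 w0' ww.
have sww := same_excess_sum ww; set s := \sum_e w e in sww.
have : 0 <= s by rewrite sumr_ge0.
rewrite le_eqVlt => /predU1P[s0|s0].
  have z0 (v : E -> R) : (forall e, 0 <= v e) -> 0 = \sum_e v e -> forall e, v e = 0.
    move=> v0 /esym/eqP; rewrite psumr_eq0 // => /allP H e.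
    by apply/eqP/(implyP (H e (mem_index_enum e))).
  by move=> e; rewrite (z0 w) // (z0 w') // -sww.
have hF v G : supp_on G v -> (forall e, 0 <= v e) -> s = \sum_e v e ->
   hull G (point_of (fun e => s^-1 * v e)).
  move=> sv v0 sE; apply/hullP; exists (fun e => s^-1 * v e); split=> //.
  - by move=> e /sv ->; rewrite mulr0.
  - by move=> e; rewrite mulr_ge0 // invr_ge0 ltW.
  - by rewrite -big_distrr /= -sE mulVf // gt_eqF.
have h1 := hF _ _ sw w0 erefl; have h2 := hF _ _ sw' w0' sww.
have ept : point_of (fun e => s^-1 * w e) =
  point_of (fun e => s^-1 * w' e) by apply/point_of_eq/same_excessZ.
have : (hull F `&` hull F')%classic (point_of (fun e => s^-1 * w e)) by split=> //; rewrite ept.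
rewrite H3 // => /hullP[v [sv v0 _ /point_of_eq ev]].
have sN : s^-1 != 0 by rewrite invr_eq0 gt_eqF.
have k G u : is_forest G -> F :&: F' \subset G -> supp_on G u ->
    same_excess (fun e => s^-1 * u e) v -> forall e, s^-1 * u e = v e.
  move=> FG sG su; have su' : supp_on G (fun e => s^-1 * u e).
    by move=> e /su ->; rewrite mulr0.
  exact: flow_unique FG su' (supp_sub sG sv).
have e1 := k _ _ FF (subsetIl _ _) sw ev.
have e2 := k _ _ FF' (subsetIr _ _) sw' _.
move=> e; apply: (mulfI sN); rewrite e1 e2 // => S; rewrite -ev.
by move/point_of_eq: ept => ->.
Qed.

(** A criterion for a family of forests to generate a triangulation. Distinct edge
sets have distinct hulls, so a simplex determines its edge set. *)
Lemma triangulation_of_trees (G : set {set E}) :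
  (forall T, G T -> is_forest T) ->
  (forall x, (forall e, 0 <= x e) -> exists2 T, G T & cone T x) ->
  (forall T T' w w', G T -> G T' -> supp_on T w -> supp_on T' w' ->
    (forall e, 0 <= w e) -> (forall e, 0 <= w' e) -> same_excess w w' -> w =1 w') ->
  is_triangulation [set s | exists T F, [/\ G T, F \subset T & s = hull F]]%classic.
Proof.
move=> GF cov cmp; split.
- move=> s [T [F [GT sF ->]]]; exists F; split=> //.
  exact: sub_forest sF (GF _ GT).
- move=> F F' FF [T [F0 [GT sF /hull_inj eF]]] sF'; exists T, F'; split=> //.
  by apply: subset_trans sF' _; rewrite eF.
- move=> F F' FF FF' [T [F0 [GT sF /hull_inj eF]]] [T' [F0' [GT' sF' /hull_inj eF']]].
  rewrite -{}eF in sF; rewrite -{}eF' in sF'.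
  apply/seteqP; split=> [q [/hullP[w [sw w0 w1 ->]] /hullP[w' [sw' w0' w1' /point_of_eq ww]]]|q hq].
    have eww := cmp T T' w w' GT GT' (supp_sub sF sw) (supp_sub sF' sw') w0 w0' ww.
    apply/hullP; exists w; split=> // e; rewrite inE negb_and => /orP[/sw//|/sw'].
    by rewrite eww.
  by split; apply: hull_sub hq; rewrite ?subsetIl ?subsetIr.
- apply/seteqP; split=> [q [s [T [F [GT sF ->]]]]|q].
    by apply: hull_sub; apply/fintype.subsetP => e _; rewrite finset.in_setT.
  move=> /hullP[x [_ x0 x1 ->]]; have [T GT [w [sw w0 wx]]] := cov x x0.
  exists (hull T); first by exists T, T.
  apply/hullP; exists w; split=> //; last by apply/esym/point_of_eq.
  by rewrite (same_excess_sum wx).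
Qed.

End Hulls.

(** * Integral points over a tree *)

Section IntegerPoints.
Variables (R : realType) (m n : nat).
Hypotheses (hm : (0 < m)%N) (hn : (0 < n)%N).
Local Notation V := ('I_m + 'I_n)%type.
Local Notation E := ('I_m * 'I_n)%type.
Implicit Types (F T : {set E}) (e f : E) (S : {set V}) (x y w z : E -> R) (a b c : 'rV[int]_m).
Local Notation excess := (@excess R m n).
Local Notation e_ := (@unit_vec m).

(** The integral point with supplies [a] and all demands equal to 1. *)
Definition content_point a : E -> R := spread (fun i => (a 0 i)%:~R).

Lemma content_point_cut T a e : is_spanning_tree T -> a \in lattice_simplex m n%:Z -> e \in T ->
  excess (cut T e) (content_point a) =
    1 - (\sum_(i | left_part (cut T e) i) (a - LDminus T) 0 i)%:~R.
Proof.
move=> tT /lattice_simplexP[_ sa] eT.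
have eqa i : (a 0 i)%:~R = (LDminus T 0 i)%:~R + ((a - LDminus T) 0 i)%:~R :> R.
  by rewrite -intrD subvvE addrC subrK.
have -> : excess (cut T e) (content_point a) = excess (cut T e)
  (spread (fun i => (LDminus T 0 i)%:~R + ((a - LDminus T) 0 i)%:~R)).
  by apply: eq_bigr => f _; rewrite /content_point /spread eqa.
rewrite excess_spread_cut ?(raddf_sum intr) //.
by under eq_bigr do rewrite -eqa; rewrite -(raddf_sum intr) /= sa.
Qed.

(** So the flow of [b + e_i] on a tree with left degrees [b + 1] is 0 or 1: orienting
the tree towards [i], it selects the edge by which each right vertex leaves. *)
Lemma content_point_cut1 T b i e : is_spanning_tree T -> LDminus T = b ->
  b \in lattice_simplex m (n%:Z - 1) -> e \in T ->
  excess (cut T e) (content_point (b + e_ i)) = 1 - (inl i \in cut T e)%:R.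
Proof.
move=> tT LD bL eT; rewrite content_point_cut // ?LD.
  by rewrite [b + _ - b]addrAC subrr add0r sum_unit_vec /left_part natz.
by have := lattice_simplexD i bL; rewrite subrK.
Qed.

Lemma content_point_cut2 T c i j k e : is_spanning_tree T -> LDminus T = c + e_ j ->
  c \in lattice_simplex m (n%:Z - 2) -> e \in T ->
  excess (cut T e) (content_point (c + e_ i + e_ k)) =
  1 - ((inl i \in cut T e)%:R + (inl k \in cut T e)%:R - (inl j \in cut T e)%:R).
Proof.
move=> tT LD cL eT; rewrite content_point_cut // ?LD.
  have -> : c + e_ i + e_ k - (c + e_ j) = e_ i + e_ k - e_ j.
    by apply/rowP => l; rewrite subvvE !(subvE, addvE) unit_vecE; ring.
  under eq_bigr do rewrite subvE mxE -[(_ == j)%:R]unit_vecE.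
  rewrite sumrB big_split /= !sum_unit_vec /left_part intrB intrD !natz.
  done.
by have := lattice_simplexD k (lattice_simplexD i cL); rewrite (_ : n%:Z - 2 + 1 + 1 = n%:Z) //;
  lia.
Qed.

Lemma left_marginal_content_point a i : left_marginal (content_point a) i = (a 0 i)%:~R.
Proof. by rewrite left_marginal_spread. Qed.

Lemma right_marginal_content_point a j : a \in lattice_simplex m n%:Z ->
  right_marginal (content_point a) j = 1.
Proof. by move=> /lattice_simplexP[_ sa];
  rewrite right_marginal_spread // -(raddf_sum intr) /= sa. Qed.

End IntegerPoints.

(** * Trianguloids as colourings indexed by a lattice point and a direction *)

Section Colouring.
Variables (m n : nat).
Local Notation e_ := (@unit_vec m).
Implicit Types (a b c : 'rV[int]_m) (col : 'rV[int]_m -> 'I_m -> {set 'I_n}).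

(** The trianguloid axioms in terms of [col b i], the label of the edge from [b] to
[b + e_i]. Writing each axiom at the common lower point [c] makes the
inclusion axiom a comparison of [c + e_k] with [c + e_i]. Only one of the two
equalities of the hexagon axiom is kept; the other follows by exchanging
[i] and [k]. *)
Record trianguloid_colouring col : Prop := TrianguloidColouring {
  col_card : forall b i, b \in lattice_simplex m (n%:Z - 1) -> #|col b i|%:Z = b 0 i + 1;
  col_cover : forall a j, a \in lattice_simplex m n%:Z ->
    exists2 i, a - e_ i \in lattice_simplex m (n%:Z - 1) & j \in col (a - e_ i) i;
  col_sub : forall c i k, c \in lattice_simplex m (n%:Z - 2) ->
    col (c + e_ k) i \subset col (c + e_ i) i;
  col_hexagon : forall c i j k, c \in lattice_simplex m (n%:Z - 2) ->
    i != j -> j != k -> i != k -> col (c + e_ i) j <> col (c + e_ k) j ->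
    col (c + e_ i) k = col (c + e_ j) k }.

Lemma is_edgeP b i : is_edge n (b, b + e_ i) = (b \in lattice_simplex m (n%:Z - 1)).
Proof.
by rewrite /is_edge /=; apply: andb_idr => _; apply/existsP; exists i.
Qed.

Lemma is_edgeBP a i : is_edge n (a - e_ i, a) = (a - e_ i \in lattice_simplex m (n%:Z - 1)).
Proof. by rewrite -{2}[a](subrK (e_ i)) is_edgeP. Qed.

Lemma lattice_simplex_up2 c i : c \in lattice_simplex m (n%:Z - 2) ->
  c + e_ i \in lattice_simplex m (n%:Z - 1).
Proof. by move=> /(lattice_simplexD i); rewrite (_ : n%:Z - 2 + 1 = n%:Z - 1) //; lia. Qed.

Lemma lattice_simplex_up1 b i : b \in lattice_simplex m (n%:Z - 1) ->
  b + e_ i \in lattice_simplex m n%:Z.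
Proof. by move=> /(lattice_simplexD i); rewrite subrK. Qed.

Lemma trianguloid_colouringP (T : edge m n -> {set 'I_n}) :
  is_trianguloid T <-> trianguloid_colouring (fun b i => at_edge T b (b + e_ i)).
Proof.
split=> [[[T1 T2 T3] T4]|[C1 C2 C3 C4]].
  split.
  - move=> b i bL; have := T1 (b + e_ i) i; rewrite is_edgeBP addrK => -> //.
    by rewrite addvE eqxx.
  - move=> a j aL; have [i [ie ji]] := T2 a j aL; exists i; rewrite -?is_edgeBP //.
    by rewrite subrK.
  - move=> c i k cL; have /= := T3 (c + e_ k + e_ i) i k.
    have -> : c + e_ k + e_ i + e_ i - e_ k = c + e_ i + e_ i.
      by rewrite addrC !addrA [- _ + c]addrC addrNK.
    rewrite !addrK; apply; rewrite ?lattice_simplex_up1 ?lattice_simplex_up2 //.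
    move/lattice_simplexP: (lattice_simplex_up2 k cL) => [/(_ i) ge0 _].
    by rewrite addvE eqxx ltr_pwDr.
  - by move=> c i j k cL ij jk ik ne; have [] := T4 c i j k cL ij jk ik ne.
split; first split.
- move=> a i; rewrite is_edgeBP => /(C1 _ i); rewrite subrK => ->.
  by rewrite subvE eqxx addrNK.
- move=> a j aL; have [i ie ji] := C2 a j aL; exists i; rewrite is_edgeBP; split=> //.
  by rewrite subrK in ji.
- move=> a i k a' aL a'L ai; have [ik|ik] := eqVneq i k.
    by rewrite /a' ik addrK.
  pose c := a - e_ i - e_ k.
  have bL : a - e_ i \in lattice_simplex m (n%:Z - 1) by rewrite lattice_simplexB.
  have cL : c \in lattice_simplex m (n%:Z - 2).
    have -> : n%:Z - 2 = n%:Z - 1 - 1 by lia.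
    rewrite lattice_simplexB //; move: a'L => /lattice_simplexP[/(_ k)].
    by rewrite /a' !subvE addvE eqxx eq_sym (negPf ik); lia.
  have := C3 c i k cL.
  have e1 : c + e_ k = a - e_ i by rewrite subrK.
  have e2 : c + e_ i = a' - e_ i.
    by rewrite /a' /c addrAC subrK addrAC addrK.
  by rewrite e1 e2 !subrK.
- move=> c i j k cL ij jk ik ne; split; first exact: (C4 c i j k).
  apply/esym; apply: (C4 c k j i) => //; rewrite 1?eq_sym //; exact/nesym.
Qed.

Lemma at_edgeE (T : edge m n -> {set 'I_n}) (e : edge m n) :
  at_edge T (val e).1 (val e).2 = T e.
Proof. by rewrite /at_edge -surjective_pairing valK. Qed.

Lemma colouring_inj (T T' : edge m n -> {set 'I_n}) :
  (forall b i, b \in lattice_simplex m (n%:Z - 1) ->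
    at_edge T b (b + e_ i) = at_edge T' b (b + e_ i)) ->
  T = T'.
Proof.
move=> TT; apply/funext => e; rewrite -!at_edgeE;
  case: e => -[b a] /= /andP[bL] /existsP[i /eqP/= ->].
exact: TT.
Qed.

Lemma at_trianguloid_of (R : realType) (tau : set (set 'rV[R]_(m + n))) b i :
  b \in lattice_simplex m (n%:Z - 1) ->
  at_edge (trianguloid_of tau) b (b + e_ i) = [set j | (i, j) \in tree_of tau b].
Proof.
move=> bL; rewrite /at_edge insubT ?is_edgeP // => be.
apply/setP => j; rewrite !inE /=; apply/existsP/idP.
  by move=> [k /andP[/eqP/addrI/unit_vec_inj <-]].
by move=> ij; exists i; rewrite eqxx.
Qed.

End Colouring.

(** * From a triangulation to its trianguloid *)

(** A path inside the cut of [e1] avoids the left end of [e0], so it joins [u] and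
[v] without using [e0]. *)
Lemma cut_avoid (m n : nat) (T : {set 'I_m * 'I_n}) e0 e1 u v : 
  inl e0.1 \notin cut T e1 -> u \in cut T e1 -> v \in cut T e1 ->
  (u \in cut T e0) = (v \in cut T e0).
Proof.
move=> e01; have key w : w \in cut T e1 -> connect (adj (T :\ e0)) (inr e1.2) w.
  rewrite inE => /connectP[p pp ->]; apply/connectP; exists p => //.
  elim: p (inr e1.2) pp (cut_right T e1) => //= y p IH x /andP[xy py] xS.
  have yS : y \in cut T e1.
    by move: xS; rewrite !inE => xS; apply: connect_trans xS (connect1 xy).
  rewrite IH // andbT.
  case: x y xy xS yS {py IH} => [i|j] [k|l] //=; rewrite !inE => /andP[_ ->] xS yS;
    rewrite andbT; apply: contraNneq e01 => <-; rewrite inE //.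
move=> /key u1 /key v1; rewrite !inE.
have uv : connect (adj (T :\ e0)) u v.
  by apply: connect_trans v1; rewrite connect_adjC.
apply/idP/idP => H; apply: connect_trans H _ => //.
by rewrite connect_adjC.
Qed.

Section FromTriangulation.
Variables (R : realType) (m n : nat).
Hypotheses (hm : (0 < m)%N) (hn : (0 < n)%N).
Variable tau : set (set 'rV[R]_(m + n)).
Hypothesis Htau : is_triangulation tau.
Local Notation V := ('I_m + 'I_n)%type.
Local Notation E := ('I_m * 'I_n)%type.
Implicit Types (F T : {set E}) (e f : E) (S : {set V}) (x y w z : E -> R) (a b c : 'rV[int]_m).
Local Notation excess := (@excess R m n).
Local Notation hull := (@root_hull R m n).
Local Notation e_ := (@unit_vec m).
Local Notation content_point := (@content_point R m n).
Local Notation barycentre := (@barycentre R m n).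

Lemma generic_tree F w x : generic x -> is_forest F -> supp_on F w -> same_excess w x ->
  is_spanning_tree F.
Proof. by move=> gx FF sw wx; split=> //; apply: connected_of_generic gx sw wx. Qed.

Lemma barycentre_sum_gt0 b : b \in lattice_simplex m (n%:Z - 1) -> 0 < \sum_e barycentre b e.
Proof.
move=> bL; rewrite sum_edges exchange_big /=.
rewrite (eq_bigr (fun=> 1)) => [|j _]; last exact: (right_marginal_barycentre R hm hn).
by rewrite sumr_const card_ord ltr0n.
Qed.

(** Some forest of the triangulation carries the barycentre; it is the required
tree. *)
Lemma tree_exists b : b \in lattice_simplex m (n%:Z - 1) ->
  exists T, triangulation_trees tau T /\ LDminus T = b.
Proof.
move=> bL; have y0 e := barycentre_ge0 R e bL.
have [F [FF tF [w [sw w0 wy]]]] := tri_cover Htau y0 (barycentre_sum_gt0 bL).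
have tT := generic_tree (barycentre_generic hm hn bL) FF sw wy.
by exists F; split=> //; exact: barycentre_degree bL tT sw w0 wy.
Qed.

(** Both trees carry the barycentre with positive flow on all their edges, and the
two flows coincide. *)
Lemma tree_unique T T' b : b \in lattice_simplex m (n%:Z - 1) ->
  triangulation_trees tau T -> triangulation_trees tau T' ->
  LDminus T = b -> LDminus T' = b -> T = T'.
Proof.
move=> bL [tT hT] [tT' hT'] LD LD'.
have pos U : is_spanning_tree U -> LDminus U = b -> forall e, e \in U ->
  0 < tree_flow U (barycentre b) e.
  by move=> tU LDU e eU; rewrite /tree_flow eU barycentre_cut.
have nneg U : is_spanning_tree U -> LDminus U = b -> forall e, 0 <= tree_flow U (barycentre b) e.
  move=> tU LDU e; case: (boolP (e \in U)) => eU; first by rewrite ltW ?pos.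
  by rewrite tree_flow_supp.
have ww : tree_flow T (barycentre b) =1 tree_flow T' (barycentre b).
  apply: (tri_unique Htau tT.1 tT'.1 hT hT'); rewrite ?tree_flow_same_excess //;
    try exact: tree_flow_supp.
  - exact: nneg.
  - exact: nneg.
  - by move=> S; rewrite !tree_flow_same_excess.
apply/setP => e; apply/idP/idP => eU; have := pos _ _ _ e eU => /(_ _ _)/lt0r_neq0 ne.
  by apply/negPn/negP => /tree_flow_supp e0; have := ne tT LD; rewrite ww e0 eqxx.
by apply/negPn/negP => /tree_flow_supp e0; have := ne tT' LD'; rewrite -ww e0 eqxx.
Qed.

Lemma tree_ofP b : b \in lattice_simplex m (n%:Z - 1) ->
  triangulation_trees tau (tree_of tau b) /\ LDminus (tree_of tau b) = b.
Proof. by move=> bL; apply: (xgetPex finset.set0 (tree_exists bL)). Qed.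

Lemma tree_of_LD T : triangulation_trees tau T -> tree_of tau (LDminus T) = T.
Proof.
move=> tT; have bL := LDminus_lattice hm hn tT.1.
have [tT' LD'] := tree_ofP bL; exact: tree_unique bL tT' tT LD' erefl.
Qed.

(** A generic point near an interior point of the simplex of [F] is carried by a tree;
as no nonzero excess has changed sign, this tree also carries the interior
point, and uniqueness of flows puts [F] inside the tree. *)
Lemma simplex_in_tree F : is_forest F -> tau (hull F) ->
  exists2 T, triangulation_trees tau T & F \subset T.
Proof.
move=> FF tF; have [b bL] := lattice_point hm hn.
pose z e : R := (e \in F)%:R.
have z0 e : 0 <= z e by rewrite ler0n.
have [x [x0 gx side [d d0 hx]]] := nearby_generic hm hn bL z0.
have sx : 0 < \sum_e x e.
  rewrite (eq_bigr (fun e => z e + d * barycentre b e)) ?big_split /= => [|e _]; last exact: hx.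
  rewrite -big_distrr /=; apply: ltr_wpDl; first exact: sumr_ge0.
  by rewrite mulr_gt0 ?barycentre_sum_gt0.
have [T [FT tT [w [sw w0 wx]]]] := tri_cover Htau x0 sx.
have TT := generic_tree gx FT sw wx.
exists T => //.
have szF : supp_on F z by move=> e /negPf eF; rewrite /z eF.
have zz : tree_flow T z =1 z.
  apply: (tri_unique Htau FT FF tT tF) => //; try exact: tree_flow_supp.
    move=> e; rewrite /tree_flow; case: ifP => // eT.
    have xp : 0 <= excess (cut T e) x by rewrite -wx flow_cut.
    have [-> //|zN] := eqVneq (excess (cut T e) z) 0.
    rewrite leNgt; apply/negP => zneg; have := side _ zN.
    by rewrite nmulr_rgt0 // ltNge xp.
  exact: tree_flow_same_excess.
apply/fintype.subsetP => e eF; apply/negPn/negP => /(tree_flow_supp z) => e0.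
by have := zz e; rewrite e0 /z eF => /eqP; rewrite eq_sym oner_eq0.
Qed.

Section Colours.
Local Notation Tr := (tree_of tau).

Lemma tree_of_spanning b : b \in lattice_simplex m (n%:Z - 1) -> is_spanning_tree (Tr b).
Proof. by case/tree_ofP => [[]]. Qed.

Lemma tree_of_LDminus b : b \in lattice_simplex m (n%:Z - 1) -> LDminus (Tr b) = b.
Proof. by case/tree_ofP. Qed.

Lemma tree_of_flow_eq b b' x : 
  b \in lattice_simplex m (n%:Z - 1) -> b' \in lattice_simplex m (n%:Z - 1) ->
  (forall e, 0 <= tree_flow (Tr b) x e) -> (forall e, 0 <= tree_flow (Tr b') x e) ->
  tree_flow (Tr b) x =1 tree_flow (Tr b') x.
Proof.
move=> bL bL' p p'; have [[tT hT] _] := tree_ofP bL; have [[tT' hT'] _] := tree_ofP bL'.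
apply: (tri_unique Htau tT.1 tT'.1 hT hT') => //; try exact: tree_flow_supp.
by move=> S; rewrite !tree_flow_same_excess.
Qed.

Lemma tree_of_content_flow b i e : b \in lattice_simplex m (n%:Z - 1) ->
  tree_flow (Tr b) (content_point (b + e_ i)) e =
    if e \in Tr b then (inl i \notin cut (Tr b) e)%:R else 0.
Proof.
move=> bL; rewrite /tree_flow; case: ifP => // eT.
rewrite content_point_cut1 ?tree_of_LDminus //; last exact: tree_of_spanning.
by case: (_ \in _); rewrite ?subrr ?subr0.
Qed.

Lemma tree_of_content_flow_ge0 b i e : b \in lattice_simplex m (n%:Z - 1) ->
  0 <= tree_flow (Tr b) (content_point (b + e_ i)) e.
Proof. by move=> bL; rewrite tree_of_content_flow //; case: ifP. Qed.

Lemma tree_of_content_flow_own b i j : b \in lattice_simplex m (n%:Z - 1) -> (i, j) \in Tr b ->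
  tree_flow (Tr b) (content_point (b + e_ i)) (i, j) = 1.
Proof.
move=> bL ij; rewrite tree_of_content_flow // ij cut_left //; by case: (tree_of_spanning bL).
Qed.

Let col b i : {set 'I_n} := [set j | (i, j) \in Tr b].

(** The point [a = b + e_i] can be read on any tree of the triangulation that
carries it, in particular on the trees of other lattice points. *)
Lemma colour_flow b i a j : b \in lattice_simplex m (n%:Z - 1) -> a = b + e_ i ->
  (forall b', b' \in lattice_simplex m (n%:Z - 1) ->
    (forall e, 0 <= tree_flow (Tr b') (content_point a) e) ->
   (j \in col b i) = (tree_flow (Tr b') (content_point a) (i, j) != 0)).
Proof.
move=> bL -> b' bL' p; rewrite inE.
rewrite -(tree_of_flow_eq bL bL') //; last by move=> e; exact: tree_of_content_flow_ge0.
case: (boolP ((i, j) \in Tr b)) => ij; first by rewrite tree_of_content_flow_own // oner_eq0.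
by rewrite tree_flow_supp // eqxx.
Qed.

(** The label of an edge into [c + e_i + e_j] is read on the tree of [c + e_j] instead
of that of [c + e_i]. *)
Lemma colour_cut c i j s : c \in lattice_simplex m (n%:Z - 2) ->
  (s \in col (c + e_ i) j) =
  ((j, s) \in Tr (c + e_ j)) && (inl i \notin cut (Tr (c + e_ j)) (j, s)).
Proof.
move=> cL; have Li := lattice_simplex_up2 i cL; have Lj := lattice_simplex_up2 j cL.
have ea : c + e_ i + e_ j = c + e_ j + e_ i by rewrite addrAC.
rewrite (@colour_flow _ _ _ _ Li (esym ea) _ Lj) => [|e]; last exact: tree_of_content_flow_ge0.
by rewrite tree_of_content_flow //; case: ifP => // _; rewrite ?eqxx // pnatr_eq0 eqb0 negbK.
Qed.

(** Hexagon axiom: if the labels at [j] differ, then [j] separates [i] from [k] in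
the tree of [c + e_j]. Hence no cut of this tree contains [i] and [k] but not
[j], and the tree also carries the point [c + e_i + e_k]. The labels of
[k] at this point are then edges of the tree, and there are as many of
them as edges at [k]. *)
Lemma triangulation_colouring : trianguloid_colouring col.
Proof.
have A1 b i : b \in lattice_simplex m (n%:Z - 1) -> #|col b i|%:Z = b 0 i + 1.
  by move=> bL; have := LDminusE (Tr b) i; rewrite tree_of_LDminus // => ->; rewrite subrK.
have A3 c i k : c \in lattice_simplex m (n%:Z - 2) -> col (c + e_ k) i \subset col (c + e_ i) i.
  move=> cL; apply/fintype.subsetP => s; rewrite (colour_cut _ _ _ cL) => /andP[sT _].
  by rewrite inE.
split=> //.
- move=> a j aL.
  have [i0 ai0] : exists i0, 0 < a 0 i0.
    apply/existsP; apply: contraT => /existsPn H; move: aL => /lattice_simplexP[a0 sa].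
    have : \sum_i a 0 i <= 0 by apply: sumr_le0 => i _; rewrite leNgt.
    by rewrite sa; lia.
  have bL : a - e_ i0 \in lattice_simplex m (n%:Z - 1) by rewrite lattice_simplexB.
  pose w := tree_flow (Tr (a - e_ i0)) (content_point a).
  have wa : same_excess w (content_point a) by apply: tree_flow_same_excess;
    exact: tree_of_spanning.
  have w0 e : 0 <= w e by have := tree_of_content_flow_ge0 i0 e bL; rewrite subrK.
  have [i wi] : exists i, w (i, j) != 0.
    apply/existsP; apply: contraT => /existsPn H.
    have := same_excess_right j wa;
      rewrite right_marginal_content_point // /right_marginal big1 => [/eqP|i _].
      by rewrite eq_sym oner_eq0.
    by have := H i; rewrite negbK => /eqP.
  have ai : 0 < a 0 i.
    have := same_excess_left i wa; rewrite left_marginal_content_point // => e1;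
      rewrite -(ltr0z R) -e1.
    rewrite /left_marginal (bigD1 j) //= ltr_pwDl ?sumr_ge0 // lt_neqAle eq_sym wi.
    exact: w0.
  have bL' : a - e_ i \in lattice_simplex m (n%:Z - 1) by rewrite lattice_simplexB.
  by exists i => //; rewrite (@colour_flow _ i a _ bL' _ _ bL w0) ?subrK.
- move=> c i j k cL ij jk ik ne.
  pose T := Tr (c + e_ j).
  have Lj := lattice_simplex_up2 j cL; have tT := tree_of_spanning Lj; have LD :=
    tree_of_LDminus Lj.
  have [s sT sik] : exists2 s, (j, s) \in T & (inl i \in cut T (j, s)) != (inl k \in cut T (j, s)).
    apply/exists_inP; apply: contraPT ne => /exists_inPn H; apply.
    apply/setP => s; rewrite !(colour_cut _ _ _ cL); case: (boolP ((j, s) \in Tr _)) => //= js.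
    by have := H s js; rewrite negbK => /eqP ->.
  (* The flow is 1 - [i] - [k] + [j] for the indicators of the cut. *)
  have p e : 0 <= tree_flow T (content_point (c + e_ i + e_ k)) e.
    rewrite /tree_flow; case: ifP => // eT; rewrite (@content_point_cut2 _ _ _ hm hn T c i j k) //.
    have : ~~ [&& inl j \notin cut T e, inl i \in cut T e & inl k \in cut T e].
      apply: contra sik => /and3P[jS iS kS]; apply/eqP.
      exact: (@cut_avoid _ _ T (j, s) e).
    by do 3 case: (_ \in _); move=> //= _; rewrite ?mulr1n ?mulr0n; lra.
  have sub : col (c + e_ i) k \subset col (c + e_ j) k.
    apply/fintype.subsetP => s'.
    rewrite (@colour_flow _ _ _ _ (lattice_simplex_up2 i cL) erefl _ Lj p) => ne0.
    by rewrite inE; apply: contraNT ne0 => /tree_flow_supp ->.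
  apply/eqP; rewrite eqEcard sub /= -lez_nat !A1 ?lattice_simplex_up2 //.
  by rewrite !addvE ![k == _]eq_sym (negPf ik) (negPf jk).
Qed.

End Colours.

End FromTriangulation.

Lemma trianguloid_of_is_trianguloid (R : realType) (m n : nat) (hm : (0 < m)%N) (hn : (0 < n)%N)
  (tau : set (set 'rV[R]_(m + n))) : is_triangulation tau -> is_trianguloid (trianguloid_of tau).
Proof.
move=> Htau; apply/trianguloid_colouringP.
have [C1 C2 C3 C4] := triangulation_colouring hm hn Htau.
split.
- by move=> b i bL; rewrite at_trianguloid_of ?C1.
- by move=> a j aL; have [i iL ji] := C2 a j aL; exists i; rewrite // at_trianguloid_of.
- by move=> c i k cL; rewrite !at_trianguloid_of ?lattice_simplex_up2 ?C3.
- by move=> c i j k cL ij jk ik; rewrite !at_trianguloid_of ?lattice_simplex_up2 //; apply: C4.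
Qed.

(** The trianguloid determines the trees, and the trees determine the simplices. *)
Lemma trianguloid_of_inj (R : realType) (m n : nat) (hm : (0 < m)%N) (hn : (0 < n)%N)
  (tau tau' : set (set 'rV[R]_(m + n))) : is_triangulation tau -> is_triangulation tau' ->
  trianguloid_of tau = trianguloid_of tau' -> tau = tau'.
Proof.
move=> H H' tt.
have Tr b : b \in lattice_simplex m (n%:Z - 1) -> tree_of tau b = tree_of tau' b.
  move=> bL; apply/setP => -[i j].
  have := at_trianguloid_of tau i bL; rewrite tt at_trianguloid_of // => /setP/(_ j).
  by rewrite !inE.
have sub (t t' : set (set 'rV[R]_(m + n))) : @is_triangulation R m n t ->
  @is_triangulation R m n t' ->
    (forall b, b \in lattice_simplex m (n%:Z - 1) -> tree_of t b = tree_of t' b) ->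
    (t `<=` t')%classic.
  move=> Ht Ht' e s ts; have [F [FF es]] := let: And4 H1 _ _ _ := Ht in H1 s ts.
  rewrite {}es in ts *.
  have [T tT FT] := simplex_in_tree hm hn Ht FF ts.
  have bL := LDminus_lattice hm hn tT.1.
  have [[tT' hT'] _] := tree_ofP hm hn Ht' bL.
  have eT : tree_of t' (LDminus T) = T by rewrite -e // (tree_of_LD hm hn Ht).
  rewrite eT in tT' hT'.
  by have [_ H2 _ _] := Ht'; exact: H2 tT'.1 hT' FT.
apply/seteqP; split; first exact: sub.
by apply: sub => // b bL; rewrite Tr.
Qed.

(** * From a trianguloid to its triangulation *)

(** An element with the fewest elements above it has none. *)
Lemma exists_maximal (I : finType) (A : {set I}) (r : rel I) :
  irreflexive r -> (forall x y z, x \in A -> y \in A -> z \in A -> r x y -> r y z -> r x z) ->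
  A != finset.set0 -> exists2 i, i \in A & forall x, x \in A -> ~~ r x i.
Proof.
move=> irr tr /set0Pn[i0 i0A].
case: (@arg_minnP _ i0 (mem A) (fun i => #|[set x in A | r x i]|) i0A) => i iA imin.
exists i => // x xA; apply/negP => rxi; have := imin x xA; rewrite leqNgt => /negP; apply.
apply: proper_card; apply/fintype.properP; split.
  apply/fintype.subsetP => y; rewrite !inE => /andP[yA ryx]; rewrite yA /=.
  exact: (tr y x i).
by exists x; rewrite !inE ?xA ?irr.
Qed.

Section FromColouring.
Variables (R : realType) (m n : nat).
Hypotheses (hm : (0 < m)%N) (hn : (0 < n)%N).
Variable col : 'rV[int]_m -> 'I_m -> {set 'I_n}.
Hypothesis Hcol : trianguloid_colouring col.
Local Notation V := ('I_m + 'I_n)%type.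
Local Notation E := ('I_m * 'I_n)%type.
Implicit Types (F T : {set E}) (e f : E) (S : {set V}) (x y w z : E -> R) (a b c : 'rV[int]_m).
Local Notation excess := (@excess R m n).
Local Notation cut_sign := (@cut_sign R m n).
Local Notation same_wall := (@same_wall R m n).
Local Notation e_ := (@unit_vec m).
Local Notation content_point := (@content_point R m n).
Local Notation barycentre := (@barycentre R m n).

Definition col_graph b : {set E} := [set e | e.2 \in col b e.1].
Local Notation G := col_graph.

(** The 0-1 matrix of the assignment of right vertices to left vertices encoded by the
labels of the edges into [a]. *)
Definition col_point a : E -> R := fun e =>
  ((a - e_ e.1 \in lattice_simplex m (n%:Z - 1)) && (e.2 \in col (a - e_ e.1) e.1))%:R.
Local Notation X := col_point.

Lemma left_marginal_col_point a i : a \in lattice_simplex m n%:Z ->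
  left_marginal (X a) i = (a 0 i)%:~R.
Proof.
move=> aL; rewrite /left_marginal /X /=; have [bL|bL] := boolP (_ \in lattice_simplex _ _) => /=.
  have := col_card Hcol i bL; rewrite subvE eqxx subrK => <-.
  rewrite -pmulrn -sum1_card natr_sum [RHS]big_mkcond /=.
  by apply: eq_bigr => j _; case: (_ \in _).
rewrite big1 //; move: bL; rewrite lattice_simplexB // -leNgt => ai.
by move/lattice_simplexP: aL => [/(_ i) a0 _]; have -> : a 0 i = 0 by lia.
Qed.

(** Each right vertex receives some label at [a], and the sizes of the labels add
up to [n], so it receives exactly one. *)
Lemma right_marginal_col_point a j : a \in lattice_simplex m n%:Z -> right_marginal (X a) j = 1.
Proof.
move=> aL; have ge1 k : 0 <= right_marginal (X a) k - 1.
  have [i iL ki] := col_cover Hcol k aL.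
  have Xi : X a (i, k) = 1 by rewrite /X /= iL ki.
  by rewrite /right_marginal (bigD1 i) //= Xi addrAC subrr add0r sumr_ge0.
have : \sum_k (right_marginal (X a) k - 1) = 0.
  rewrite sumrB /right_marginal exchange_big /= sumr_const card_ord.
  under eq_bigr do rewrite -/(left_marginal (X a) _) left_marginal_col_point //.
  by rewrite -(raddf_sum intr) /=; move/lattice_simplexP: aL => [_ ->]; rewrite subrr.
move=> /eqP; rewrite psumr_eq0 => [/allP H|k _]; last exact: ge1.
have := H j (mem_index_enum _).
by rewrite /= subr_eq0 => /eqP.
Qed.

Lemma col_point_same_excess a : a \in lattice_simplex m n%:Z -> same_excess (X a) (content_point a).
Proof.
move=> aL; apply: same_excessP => [i|j].
  by rewrite left_marginal_col_point // left_marginal_content_point.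
by rewrite right_marginal_col_point // right_marginal_content_point.
Qed.

Lemma col_point_supp b k : b \in lattice_simplex m (n%:Z - 1) -> supp_on (G b) (X (b + e_ k)).
Proof.
move=> bL [i j]; rewrite inE /X /= => jb.
case: (boolP (_ \in lattice_simplex _ _)) => //= b'L; suff ->
  : (j \in col (b + e_ k - e_ i) i) = false by [].
apply: contraNF jb; have [->|ik] := eqVneq i k; first by rewrite addrK.
have cL : b - e_ i \in lattice_simplex m (n%:Z - 2).
  have -> : n%:Z - 2 = n%:Z - 1 - 1 by lia.
  rewrite lattice_simplexB //; move/lattice_simplexP: b'L => [/(_ i) + _].
  by rewrite subvE addvE eqxx (negPf ik); lia.
have := col_sub Hcol i k cL; rewrite subrK addrAC => /fintype.subsetP; exact.
Qed.

Lemma col_graph_LDminus b : b \in lattice_simplex m (n%:Z - 1) -> LDminus (G b) = b.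
Proof.
move=> bL; apply/rowP => i; rewrite LDminusE -[b 0 i](addrK 1) -(col_card Hcol i bL);
  congr (Posz _ - _).
by apply: eq_card => j; rewrite !inE.
Qed.

(** The graph carries the mean of the points [b + e_k], which is generic, and it has
the number of edges of a tree. *)
Lemma col_graph_tree b : b \in lattice_simplex m (n%:Z - 1) -> is_spanning_tree (G b).
Proof.
move=> bL; apply: connected_tree => //; last first.
  have := sum_LDminus (G b); rewrite col_graph_LDminus //; move/lattice_simplexP: bL => [_ ->]; lia.
pose w e := \sum_k m%:R^-1 * X (b + e_ k) e.
apply: (@connected_of_generic R m n (G b) w _ hm hn (barycentre_generic hm hn bL)).
  by move=> e eG; rewrite /w big1 // => k _; rewrite col_point_supp ?mulr0.
move=> S; rewrite excess_sum.
have sy := sum_barycentre R hm bL.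
have hX k : excess S (X (b + e_ k)) =
  #|right_part S|%:R - (\sum_(i | left_part S i) b 0 i)%:~R - (left_part S k)%:R.
  rewrite (col_point_same_excess (lattice_simplex_up1 k bL)) /content_point excess_spread //;
    last first.
    by rewrite -(raddf_sum intr) /=; move/lattice_simplexP: (lattice_simplex_up1 k bL) => [_ ->].
  rewrite -(raddf_sum intr) /=; under eq_bigr do rewrite addvE -unit_vecE.
  by rewrite big_split /= sum_unit_vec intrD natz opprD addrA.
under eq_bigr do rewrite hX mulrBr.
rewrite sumrB sumr_const card_ord -big_distrr /= -[_ *+ m]mulr_natr mulrAC
  mulVf ?natr_m_neq0 // mul1r.
rewrite /barycentre excess_spread // big_split /= sumr_const -(raddf_sum intr) /= opprD addrA;
  congr (_ - _).
rewrite -[RHS]mulr_natr; congr (_ * _).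
by rewrite -natr_sum -sum1_card [in RHS]big_mkcond; congr (_%:R); apply: eq_bigr => i _;
  rewrite inE; case: (left_part S i).
Qed.

Lemma col_graph_flow a b : a \in lattice_simplex m n%:Z -> b \in lattice_simplex m (n%:Z - 1) ->
  supp_on (G b) (X a) -> forall e, e \in G b -> X a e = excess (cut (G b) e) (content_point a).
Proof.
move=> aL bL sX e eG; rewrite -(col_point_same_excess aL) flow_cut //; by case: (col_graph_tree bL).
Qed.

Lemma col_graph_cut c i j s : c \in lattice_simplex m (n%:Z - 2) ->
  (s \in col (c + e_ i) j) =
  ((j, s) \in G (c + e_ j)) && (inl i \notin cut (G (c + e_ j)) (j, s)).
Proof.
move=> cL; have Li := lattice_simplex_up2 i cL; have Lj := lattice_simplex_up2 j cL.
have ea : c + e_ j + e_ i - e_ j = c + e_ i by rewrite [c + _ + _]addrAC addrK.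
have Xs : X (c + e_ j + e_ i) (j, s) = (s \in col (c + e_ i) j)%:R.
  by rewrite /X /= ea Li.
have sX := col_point_supp i Lj.
case: (boolP ((j, s) \in G _)) => /= js; last first.
  by have := sX _ js; rewrite Xs => /eqP; rewrite pnatr_eq0 eqb0 => /negPf.
have := col_graph_flow (lattice_simplex_up1 i Lj) Lj sX js;
  rewrite Xs content_point_cut1 ?col_graph_LDminus //; last exact: col_graph_tree.
by do 2 case: (_ \in _); rewrite ?subrr ?subr0 => // /eqP; rewrite ?oner_eq0 // eq_sym oner_eq0.
Qed.

Lemma col_own_card c i j : c \in lattice_simplex m (n%:Z - 2) -> i != j ->
  #|col (c + e_ j) j| = #|col (c + e_ i) j|.+1.
Proof.
move=> cL ij; apply/eqP;
  rewrite -eqz_nat intS [1 + _]addrC !(col_card Hcol) ?lattice_simplex_up2 //.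
by rewrite !addvE eqxx eq_sym [j == i]eq_sym (negPf ij) addr0 addrAC.
Qed.

(** Read as an order on the left vertices other than [k], with [x] above [i]: by the
hexagon axiom the relation is antisymmetric and transitive there. *)
Definition beats c (k x i : 'I_m) := col (c + e_ k) x != col (c + e_ i) x.

Lemma beats_anti c (k x i : 'I_m) : c \in lattice_simplex m (n%:Z - 2) ->
  k != x -> x != i -> k != i -> beats c k x i -> ~~ beats c k i x.
Proof.
move=> cL kx xi ki /eqP b; rewrite negbK; apply/eqP.
exact: (col_hexagon Hcol cL kx xi ki b).
Qed.

Lemma beats_trans c (k y x i : 'I_m) : c \in lattice_simplex m (n%:Z - 2) -> k != y -> k != x ->
  k != i ->
  beats c k y x -> beats c k x i -> beats c k y i.
Proof.
move=> cL ky kx ki yx xi; apply/negP => /eqP e1.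
have [exy|xy] := eqVneq x y.
  by move: xi; rewrite exy /beats e1 eqxx.
have [eyi|yi] := eqVneq y i.
  by rewrite eyi in xy yx; have := beats_anti cL kx xy ki xi; rewrite yx.
have [exi|ix] := eqVneq i x.
  by move: yx; rewrite -exi /beats e1 eqxx.
have e2 : col (c + e_ k) x = col (c + e_ y) x.
  by apply: (col_hexagon Hcol cL ky _ kx (elimN eqP yx)); rewrite eq_sym.
have ne : col (c + e_ x) y <> col (c + e_ i) y.
  by move=> e3; move: yx; rewrite /beats e3 e1 eqxx.
have e4 : col (c + e_ i) x = col (c + e_ y) x.
  by apply: (col_hexagon Hcol cL (i := i) (j := y) (k := x) _ _ ix (nesym ne)); rewrite eq_sym.
by move: xi; rewrite /beats e2 e4 eqxx.
Qed.

(** For a maximal [i] across [e], the labels of [c + e_i] at the vertices other than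
[i] and [e.1] are those of [c + e_k] with [k = e.1]; the label at [k] loses
[e.2] and the label at [i] gains one element. *)
Lemma flip c e : c \in lattice_simplex m (n%:Z - 2) -> e \in G (c + e_ e.1) ->
  (exists i, inl i \in cut (G (c + e_ e.1)) e) ->
  exists e', [/\ inl e'.1 \in cut (G (c + e_ e.1)) e, e' \notin G (c + e_ e.1) &
    G (c + e_ e'.1) = e' |: (G (c + e_ e.1) :\ e)].
Proof.
case: e => k j /= cL eG [i0 i0A]; pose T := G (c + e_ k).
have Lk := lattice_simplex_up2 k cL; have tT := col_graph_tree Lk.
pose A := [set i | inl i \in cut T (k, j)].
have kA i : i \in A -> k != i.
  by rewrite inE => iA; apply: contraTneq iA => <-; apply: (cut_left (e := (k, j))); case: tT.
have kcol i : (j \in col (c + e_ i) k) = (i \notin A).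
  by rewrite col_graph_cut // eG [i \in A]inE.
have [i iA imax] : exists2 i, i \in A & forall x : 'I_m, x \in A -> ~~ ((x != i) && beats c k x i).
  apply: (@exists_maximal _ A (fun x i : 'I_m => (x != i) && beats c k x i)).
  - by move=> x; rewrite eqxx.
  - move=> y x i yA xA iA /andP[yx b1] /andP[xi b2].
    rewrite (beats_trans cL _ _ _ b1 b2) ?kA // andbT; apply: contraTneq b1 => ->.
    by apply: beats_anti => //; exact: kA.
  - by apply/set0Pn; exists i0; rewrite inE.
have ki := kA _ iA.
have colx (x : 'I_m) : x != k -> x != i -> col (c + e_ i) x = col (c + e_ k) x.
  move=> xk xi; apply/esym/eqP; apply: contraT => ne.
  have kx : k != x by rewrite eq_sym.
  have e2 : col (c + e_ i) k = col (c + e_ x) k.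
    apply: (col_hexagon Hcol cL (i := i) (j := x) (k := k)); rewrite // 1?eq_sym //.
    exact/nesym/eqP.
  have xA : x \in A by have := kcol x; rewrite -e2 kcol iA => /esym/negbFE.
  by have := imax x xA; rewrite xi /= negbK /beats (negPf ne).
have colk : col (c + e_ i) k = col (c + e_ k) k :\ j.
  apply/eqP; rewrite eqEcard; apply/andP; split.
    apply/fintype.subsetP => s si; rewrite !inE (fintype.subsetP (col_sub Hcol k i cL)) // andbT.
    by apply: contraTneq si => ->; rewrite kcol negbK.
  have := col_own_card cL (i := i) (j := k); rewrite eq_sym => /(_ ki).
  rewrite (cardsD1 j) (_ : j \in col _ k = true); last by move: eG; rewrite inE.
  by rewrite add1n => -[->].
have [j' j'k j'i] : exists2 j', j' \notin col (c + e_ k) i &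
  col (c + e_ i) i = j' |: col (c + e_ k) i.
  have sub := col_sub Hcol i k cL.
  have : 0 < #|col (c + e_ i) i :\: col (c + e_ k) i|%:Z.
    have := col_own_card cL (i := k) (j := i) ki.
    by have := cardsID (col (c + e_ k) i) (col (c + e_ i) i); have /setIidPr -> := sub; lia.
  rewrite ltz_nat card_gt0 => /set0Pn[j']; rewrite inE => /andP[j'k j'i]; exists j' => //.
  apply/esym/eqP; rewrite eqEcard; apply/andP; split.
    by rewrite subUset sub1set j'i.
  by rewrite cardsU1 j'k add1n (col_own_card cL ki).
exists (i, j'); split=> /=; first by move: iA; rewrite inE.
  by rewrite inE.
apply/setP => -[x s]; rewrite !inE /= !xpair_eqE.
have [->|xi] := eqVneq x i.
  by rewrite j'i !inE [i == k]eq_sym (negPf ki).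
have [->|xk] := eqVneq x k; first by rewrite colk !inE.
by rewrite colx.
Qed.

(** Two trees sharing all edges but one, on opposite sides of the same wall. *)
Record flipped b e b' e' : Prop := Flipped {
  flipped_base : exists c, [/\ c \in lattice_simplex m (n%:Z - 2), b = c + e_ e.1 &
    b' = c + e_ e'.1];
  flipped_in : e \in G b;
  flipped_in' : e' \in G b';
  flipped_common : G b' :\ e' = G b :\ e;
  flipped_kap : forall f, cut_sign (cut (G b') e') f = - cut_sign (cut (G b) e) f }.

Lemma flip_flipped c e : c \in lattice_simplex m (n%:Z - 2) -> e \in G (c + e_ e.1) ->
  (exists i, inl i \in cut (G (c + e_ e.1)) e) ->
  exists e', flipped (c + e_ e.1) e (c + e_ e'.1) e'.
Proof.
move=> cL eG A; have [e' [e'A e'N GE]] := flip cL eG A.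
set b := c + e_ e.1 in eG A e'A e'N GE *; set b' := c + e_ e'.1 in GE *.
have e'G : e' \in G b' by rewrite GE setU11.
have com : G b' :\ e' = G b :\ e.
  by rewrite GE setU1K // inE (negPf e'N) andbF.
have tT := col_graph_tree (lattice_simplex_up2 e.1 cL); have tT' :=
  col_graph_tree (lattice_simplex_up2 e'.1 cL).
rewrite -/b in tT; rewrite -/b' in tT'.
exists e'; split=> //; first by exists c.
set S := cut (G b) e.
(* Otherwise the ends of [e'] would be joined in the new tree without [e']. *)
have j'S : inr e'.2 \notin S.
  apply: contra (forest_bridge tT'.1 e'G) => j'S; rewrite com.
  move: j'S e'A; rewrite !inE => j'S e'A; apply: connect_trans e'A.
  by rewrite connect_adjC.
have ke' : cut_sign S e' = -1 by rewrite cut_signE e'A (negPf j'S) sub0r.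
have hS x : excess S x = - excess (cut (G b') e') x.
  rewrite (excess_tree x S tT') (bigD1 e') //= ke' mulN1r big1 ?addr0 // => f /andP[fG fe].
  have : f \in G b' :\ e' by rewrite in_setD1 fe.
  by rewrite com => /setD1P[fe0 fG0]; rewrite cut_sign_cut ?(negPf fe0) ?mul0r //; case: tT.
by move=> f; rewrite -!excess_delta hS opprK.
Qed.

(** If [e1] and [e2] had different left ends [k1] and [k2], the point of content
[c + e_k1 + e_k2] would be carried by both trees, hence avoid [e1], which
puts [k2] in the cut of [e1]; but this cut is that of [e2], which does not
contain its own left end [k2]. *)
Lemma flipped_inj b1 e1 b2 e2 b' e' : flipped b1 e1 b' e' -> flipped b2 e2 b' e' -> b1 = b2.
Proof.
move=> [[c [cL eb1 eb']] e1G e'G com1 k1] [[c2 [_ eb2 eb'2]] e2G _ com2 k2].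
have cc : c2 = c by apply: (@addIr _ (e_ e'.1)); rewrite -eb' -eb'2.
rewrite {}cc {eb'2 c2} in eb2.
have [e12|ne] := eqVneq e1.1 e2.1; first by rewrite eb1 eb2 e12.
have L1 : b1 \in lattice_simplex m (n%:Z - 1) by rewrite eb1 lattice_simplex_up2.
have L2 : b2 \in lattice_simplex m (n%:Z - 1) by rewrite eb2 lattice_simplex_up2.
have e1N : e1 \notin G b2.
  apply/negP => e1G2; have : e1 \in G b2 :\ e2.
    by rewrite in_setD1 e1G2 andbT; apply: contraNneq ne => ->.
  by rewrite -com2 com1 in_setD1 eqxx.
have s2 : X (b1 + e_ e2.1) e1 = 0.
  rewrite (_ : b1 + e_ e2.1 = b2 + e_ e1.1) ?(col_point_supp _ L2 e1N) //.
  by rewrite eb1 eb2 addrAC.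
have := col_graph_flow (lattice_simplex_up1 e2.1 L1) L1 (col_point_supp _ L1) e1G.
rewrite s2 content_point_cut1 ?col_graph_LDminus //; last exact: col_graph_tree.
have : cut_sign (cut (G b1) e1) e2 = 1.
  have /eqP := k1 e2; rewrite k2 eqr_opp => /eqP <-.
  by rewrite cut_sign_cut ?eqxx //; case: (col_graph_tree L2).
move=> q1 q2; exfalso; move: q1 q2.
by rewrite cut_signE; do 2 case: (_ \in _); rewrite ?mulr1n ?mulr0n; lra.
Qed.

(** Strict inequalities: the point is interior to the simplex of the tree. *)
Definition covers b x : Prop := forall e, e \in G b -> 0 < excess (cut (G b) e) x.

Lemma cut_nontriv b e : b \in lattice_simplex m (n%:Z - 1) -> e \in G b -> nontriv R (cut (G b) e).
Proof.
move=> bL eG; apply/existsP; exists e; rewrite cut_sign_cut ?eqxx ?oner_eq0 //.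
by case: (col_graph_tree bL).
Qed.

Lemma covers_same b x y : b \in lattice_simplex m (n%:Z - 1) -> same_side x y -> covers b x ->
  covers b y.
Proof.
move=> bL xy bx e eG; have := xy _ (cut_nontriv bL eG).
by rewrite pmulr_rgt0 ?bx.
Qed.

Lemma same_wall_edge_eq b e f S : b \in lattice_simplex m (n%:Z - 1) -> e \in G b -> f \in G b ->
  same_wall (cut (G b) e) S -> same_wall (cut (G b) f) S -> e = f.
Proof.
move=> bL eG fG se sf; have FG : is_forest (G b) by case: (col_graph_tree bL).
have ke : cut_sign S e != 0.
  case: (same_wallP se) => H; have := H (fun g => (g == e)%:R);
    rewrite !excess_delta cut_sign_cut // eqxx.
    by move<-; exact: oner_neq0.
  by move=> k1; rewrite -oppr_eq0 -k1 oner_neq0.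
apply: contraNeq ke => ef.
case: (same_wallP sf) => H; have := H (fun g => (g == e)%:R);
  rewrite !excess_delta cut_sign_cut // (negPf ef) => /eqP.
  by rewrite eq_sym.
by rewrite eq_sym oppr_eq0.
Qed.

(** If no edge of the tree lies on the wall that is crossed, the tree still covers the
new point. Otherwise it is flipped at that edge, which is possible because a
leaf edge carries a marginal of the new point, and this is nonnegative. The
flow at the crossing point avoids the edge, so it lives on the new tree too,
and the signs on the other edges are unchanged. *)
Lemma crossing_covers b x xs x' S0 : crossing x xs x' S0 ->
  b \in lattice_simplex m (n%:Z - 1) -> covers b x ->
  exists b', [/\ b' \in lattice_simplex m (n%:Z - 1), covers b' x' &
    (b' = b /\ forall e, e \in G b -> ~~ same_wall (cut (G b) e) S0) \/
    (exists e e', [/\ flipped b e b' e', same_wall (cut (G b) e) S0 &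
      same_wall (cut (G b') e') S0])].
Proof.
move=> [wall sides others x'0] bL bx.
have [[e eG eS]|none] := pselect (exists2 e, e \in G b & same_wall (cut (G b) e) S0); last first.
  have none' e : e \in G b -> ~~ same_wall (cut (G b) e) S0 by move=> eG; apply/negP => eS;
    apply: none; exists e.
  exists b; split=> //; last by left.
  move=> e eG; have [_] := others _ (cut_nontriv bL eG) (none' e eG).
  by rewrite pmulr_rgt0 ?bx.
have tT := col_graph_tree bL; have FT : is_forest (G b) by case: tT.
have x'e : excess (cut (G b) e) x' < 0.
  have : excess (cut (G b) e) x * excess (cut (G b) e) x' < 0.
    by case: (same_wallP eS) => H; rewrite !H ?mulrNN.
  by rewrite pmulr_rlt0 ?bx.
have xse : excess (cut (G b) e) xs = 0 by case: (same_wallP eS) => H; rewrite H wall ?oppr0.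
(* If [e] were the only edge at [e.1], its negative flow would be the supply of [e.1]. *)
have be : 0 < b 0 e.1.
  rewrite lt_neqAle; move/lattice_simplexP: (bL) => [-> _]; rewrite andbT; apply/eqP => b0.
  have deg1 : #|[set j | (e.1, j) \in G b]| = 1%N.
    suff : ldeg (G b) e.1 = 1%N by [].
    by have := LDminusE (G b) e.1; rewrite col_graph_LDminus // -b0; lia.
  have eN f : f \in G b -> f != e -> f.1 != e.1.
    move=> fG; apply: contraNneq => fe; have /eqP/cards1P[j jE] := deg1.
    have : f.2 \in [set j | (e.1, j) \in G b] by rewrite inE -fe -surjective_pairing.
    have : e.2 \in [set j | (e.1, j) \in G b] by rewrite inE -surjective_pairing.
    by rewrite jE !inE => /eqP e2 /eqP f2;
      rewrite [f]surjective_pairing [e]surjective_pairing fe e2 f2.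
  have := excess_tree x' [set inl e.1] tT; rewrite (bigD1 e) //= big1 ?addr0.
    rewrite excess_left cut_signE !inE eqxx sub0r mulN1r => /oppr_inj e1.
    by move: x'e; rewrite -e1 ltNge /left_marginal sumr_ge0.
  move=> f /andP[fG fe]; rewrite cut_signE !inE /= (inj_eq inl_inj) (negPf (eN f fG fe)).
  by rewrite subrr mul0r.
have cL : b - e_ e.1 \in lattice_simplex m (n%:Z - 2).
  by have -> : n%:Z - 2 = n%:Z - 1 - 1 by [lia]; rewrite lattice_simplexB.
have bE : b = b - e_ e.1 + e_ e.1 by rewrite subrK.
(* A cut without left vertices has nonnegative excess. *)
have A : exists i, inl i \in cut (G b) e.
  apply/existsP; apply: contraT => /existsPn H.
  move: x'e; rewrite excess_marginals [X in _ - X]big_pred0 ?subr0 => [|i]; last exact/negbTE/H.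
  by rewrite ltNge sumr_ge0 // => j _; rewrite /right_marginal sumr_ge0.
have [e' fl] : exists e', flipped b e (b - e_ e.1 + e_ e'.1) e'.
  by have := @flip_flipped _ e cL; rewrite -bE; apply.
set b' := b - e_ e.1 + e_ e'.1 in fl;
  have b'L : b' \in lattice_simplex m (n%:Z - 1) by exact: lattice_simplex_up2.
have [_ _ e'G com kk] := fl.
have hh y : excess (cut (G b') e') y = - excess (cut (G b) e) y.
  by rewrite !excessE -sumrN; apply: eq_bigr => f _; rewrite kk mulNr.
have e'S : same_wall (cut (G b') e') S0.
  case/orP: eS => /forallP H; apply/orP; [right|left]; apply/forallP => f;
    rewrite kk (eqP (H f)) ?opprK //.
exists b'; split=> //; last by right; exists e, e'.
have tT' := col_graph_tree b'L.
have flowE : tree_flow (G b') xs =1 tree_flow (G b) xs.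
  apply: tree_flow_unique; [by case: tT'| |exact: tree_flow_same_excess].
  move=> f fG'; have [->|fe] := eqVneq f e; first by rewrite /tree_flow eG.
  apply: tree_flow_supp; apply: contra fG' => fG.
  have : f \in G b :\ e by rewrite in_setD1 fe.
  by rewrite -com in_setD1 => /andP[].
move=> f fG'; have [->|fe'] := eqVneq f e'; first by rewrite hh oppr_gt0.
have : f \in G b' :\ e' by rewrite in_setD1 fe'.
rewrite com => /setD1P[fe fG].
have nS : ~~ same_wall (cut (G b) f) S0.
  by apply: contra fe => fS; apply/eqP; exact: same_wall_edge_eq bL fG eG fS eS.
have nS' : ~~ same_wall (cut (G b') f) S0.
  by apply: contra fe' => fS; apply/eqP; exact: same_wall_edge_eq b'L fG' e'G fS e'S.
have [o1 _] := others _ (cut_nontriv bL fG) nS.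
have [o2 o3] := others _ (cut_nontriv b'L fG') nS'.
have := flowE f; rewrite /tree_flow fG fG' => fE.
have xsf : 0 < excess (cut (G b') f) xs by rewrite fE; move: o1; rewrite pmulr_rgt0 ?bx.
by move: o2 o3; rewrite pmulr_lgt0 // => xf; rewrite pmulr_rgt0.
Qed.

(** Walls that are crossed have excess 0 at [z], whereas the edges of [F] carry a
nonzero flow of [z]; so no flip removes an edge of [F]. *)
Lemma walk_covers F z x0 x1 : (forall e, 0 <= x0 e) -> (forall e, 0 <= x1 e) ->
  generic x0 -> generic x1 -> general_position x0 x1 ->
  supp_on F z -> (forall e, e \in F -> z e != 0) ->
  (forall S, S \in separating x0 x1 -> excess S z = 0) ->
  (exists b, [/\ b \in lattice_simplex m (n%:Z - 1), F \subset G b & covers b x0]) ->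
  exists b, [/\ b \in lattice_simplex m (n%:Z - 1), F \subset G b & covers b x1].
Proof.
move=> p0 p1 g0 g1 gp sz zF.
apply: (@walk _ _ _ (fun x => exists b, [/\ b \in lattice_simplex m (n%:Z - 1), F \subset G b &
  covers b x])
  (fun S => excess S z = 0)) => //.
  move=> x y xy [b [bL FG bx]]; exists b; split=> //; exact: covers_same bx.
move=> x xs x' S c Sz [b [bL FG bx]].
have [b' [b'L b'x [[bb _]|[e [e' [fl eS _]]]]]] := crossing_covers c bL bx; exists b'; split=> //.
  by rewrite bb.
have FT : is_forest (G b) by case: (col_graph_tree bL).
have eF : e \notin F.
  apply/negP => eF; have := zF _ eF.
  rewrite -(flow_cut FT (supp_sub FG sz) (flipped_in fl)).
  by case: (same_wallP eS) => ->; rewrite Sz ?oppr0 eqxx.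
apply/fintype.subsetP => f fF; have : f \in G b :\ e.
  by rewrite in_setD1 (fintype.subsetP FG) // andbT; apply: contraNneq eF => <-.
by rewrite -(flipped_common fl) in_setD1 => /andP[].
Qed.

(** Flips are injective, so two trees remain distinct all along the walk. *)
Lemma walk_covers2 x0 x1 : (forall e, 0 <= x0 e) -> (forall e, 0 <= x1 e) ->
  generic x0 -> generic x1 -> general_position x0 x1 ->
  (exists b1 b2, [/\ b1 \in lattice_simplex m (n%:Z - 1), b2 \in lattice_simplex m (n%:Z - 1),
    b1 <> b2, covers b1 x0 & covers b2 x0]) ->
  exists b1 b2, [/\ b1 \in lattice_simplex m (n%:Z - 1), b2 \in lattice_simplex m (n%:Z - 1),
    b1 <> b2, covers b1 x1 & covers b2 x1].
Proof.
move=> p0 p1 g0 g1 gp.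
apply: (@walk _ _ _ (fun x => exists b1 b2, [/\ b1 \in lattice_simplex m (n%:Z - 1),
    b2 \in lattice_simplex m (n%:Z - 1), b1 <> b2, covers b1 x & covers b2 x])
  (fun S => True)) => //.
  by move=> x y xy [b1 [b2 [L1 L2 ne c1 c2]]]; exists b1, b2; split=> //; apply: covers_same xy _.
move=> x xs x' S c _ [b1 [b2 [L1 L2 ne c1 c2]]].
have [b1' [L1' c1' H1]] := crossing_covers c L1 c1; have [b2' [L2' c2' H2]] :=
  crossing_covers c L2 c2.
exists b1', b2'; split=> // bb; rewrite -{b2'}bb in L2' c2' H2.
case: H1 H2 => [[e1 N1]|[e1 [e1' [fl1 s1 s1']]]] [[e2 N2]|[e2 [e2' [fl2 s2 s2']]]].
- by apply: ne; rewrite -e1 -e2.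
- by have := N1 e2'; rewrite -e1 s2' (flipped_in' fl2) => /(_ isT).
- by have := N2 e1'; rewrite -e2 s1' (flipped_in' fl1) => /(_ isT).
- have e12 := same_wall_edge_eq L1' (flipped_in' fl1) (flipped_in' fl2) s1' s2'.
  by rewrite -e12 in fl2; exact: ne (flipped_inj fl1 fl2).
Qed.

Lemma covers_barycentre b b0 : b \in lattice_simplex m (n%:Z - 1) ->
  b0 \in lattice_simplex m (n%:Z - 1) ->
  covers b (barycentre b0) -> b = b0.
Proof.
move=> bL b0L bx; have tT := col_graph_tree bL.
rewrite -(col_graph_LDminus bL);
  apply: (barycentre_degree hm hn b0L tT (@tree_flow_supp _ _ _ (G b) (barycentre b0))).
  by move=> e; rewrite /tree_flow; case: ifP => // /bx/ltW.
exact: tree_flow_same_excess.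
Qed.

Lemma covers_own b : b \in lattice_simplex m (n%:Z - 1) -> covers b (barycentre b).
Proof. by move=> bL e eG; apply: barycentre_cut => //;
  [exact: col_graph_tree|exact: col_graph_LDminus]. Qed.

Lemma col_graph_cover x : (forall e, 0 <= x e) -> exists2 b, b \in lattice_simplex m (n%:Z - 1) &
  cone (G b) x.
Proof.
move=> x0; have [b0 b0L] := lattice_point hm hn.
have gy := barycentre_generic (R := R) hm hn b0L.
have [x1 [p1 g1 gp near]] := generic_perturbation (J := unit) x0 (fun=> gy).
have [b [bL _ bx]] : exists b, [/\ b \in lattice_simplex m (n%:Z - 1), finset.set0 \subset G b &
  covers b x1].
  apply: (walk_covers (z := fun=> 0) (F := finset.set0) _ p1 gy g1 (gp tt)) => //.
  - by move=> e; apply: barycentre_ge0.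
  - by move=> e; rewrite inE.
  - by move=> S _; rewrite excessE big1 // => e _; rewrite mulr0.
  - by exists b0; split=> //; [exact: finset.sub0set|exact: covers_own].
exists b => //; exists (tree_flow (G b) x); split; first exact: tree_flow_supp.
  move=> e; rewrite /tree_flow; case: ifP => // eG.
  have [-> //|/near] := eqVneq (excess (cut (G b) e) x) 0.
  by rewrite pmulr_lgt0 ?bx // => /ltW.
by apply: tree_flow_same_excess; exact: col_graph_tree.
Qed.

(** From generic points near the common point, one inside each simplex, walk to a
third generic point nearby: it is covered by a tree containing the support of
[w] and by one containing the support of [w']. If these trees were distinct,
walking on to a barycentre would give two trees covering it. *)
Lemma col_graph_compatible b1 b2 w w' : b1 \in lattice_simplex m (n%:Z - 1) ->
  b2 \in lattice_simplex m (n%:Z - 1) ->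
  supp_on (G b1) w -> supp_on (G b2) w' -> (forall e, 0 <= w e) -> (forall e, 0 <= w' e) ->
  same_excess w w' -> w =1 w'.
Proof.
move=> L1 L2 s1 s2 w0 w0' ww.
have [x1 [p1 g1 n1 [d1 d10 x1E]]] := nearby_generic hm hn L1 w0.
have [x2 [p2 g2 n2 [d2 d20 x2E]]] := nearby_generic hm hn L2 w0'.
have gy := barycentre_generic (R := R) hm hn L1.
pose pts (o : option bool) :=
  match o with None => barycentre b1 | Some true => x1 | Some false => x2 end.
have gpts o : generic (pts o) by case: o => [[]|].
have [x [p g gp near]] := generic_perturbation w0 gpts.
have near' S : excess S w' != 0 -> 0 < excess S w' * excess S x by rewrite -(ww S); exact: near.
have key b v y d : b \in lattice_simplex m (n%:Z - 1) -> supp_on (G b) v -> (forall e, 0 <= v e) ->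
    (forall e, 0 <= y e) -> generic y -> general_position y x ->
    (forall S, excess S v != 0 -> 0 < excess S v * excess S y) -> (forall S, excess S v != 0 ->
      0 < excess S v * excess S x) ->
    0 < d -> (forall e, y e = v e + d * barycentre b e) ->
    exists b', [/\ b' \in lattice_simplex m (n%:Z - 1), supp_on (G b') v & covers b' x].
  move=> bL sv v0 py gy' gpy ny nx d0 yE; pose F := [set e | v e != 0].
  have sF : supp_on F v by move=> e; rewrite inE negbK => /eqP.
  have [b' [b'L FG b'x]] : exists b, [/\ b \in lattice_simplex m (n%:Z - 1), F \subset G b &
    covers b x].
    apply: (walk_covers py p gy' g gpy sF) => [e|S|].
    - by rewrite inE.
    - rewrite inE => neg; apply: contraTeq neg => vS; rewrite -leNgt ltW //.
      by apply: (mul_pos_trans (b := excess S v)); rewrite ?nx // mulrC ny.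
    - exists b; split=> //.
        by apply/fintype.subsetP => e; rewrite inE; apply: contraNT => /sv ->.
      move=> e eG; have ->
        : excess (cut (G b) e) y = excess (cut (G b) e) (fun e => v e + d * barycentre b e).
        by apply: eq_bigr => f _; rewrite yE.
      rewrite excessD flow_cut ?ltr_wpDl // ?mulr_gt0 ?covers_own //; by case: (col_graph_tree bL).
  by exists b'; split=> //; exact: supp_sub sF.
have [b1' [L1' s1' c1']] := key _ _ _ _ L1 s1 w0 p1 g1 (gp (Some true)) n1 near d10 x1E.
have [b2' [L2' s2' c2']] := key _ _ _ _ L2 s2 w0' p2 g2 (gp (Some false)) n2 near' d20 x2E.
have bb : b1' = b2'.
  apply/eqP; apply: contraT => /eqP ne.
  have y0 e := barycentre_ge0 R e L1.
  have two : exists b1 b2, [/\ b1 \in lattice_simplex m (n%:Z - 1),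
      b2 \in lattice_simplex m (n%:Z - 1), b1 <> b2, covers b1 x & covers b2 x].
    by exists b1', b2'.
  have [a1 [a2 [A1 A2 nea d1' d2']]] := walk_covers2 p y0 g gy (general_position_sym (gp None)) two.
  by case: nea; rewrite (covers_barycentre A1 L1 d1') (covers_barycentre A2 L1 d2').
rewrite -bb in s2'; apply: flow_unique s1' s2' ww; by case: (col_graph_tree L1').
Qed.

Definition col_triangulation : set (set 'rV[R]_(m + n)) :=
  [set s | exists T F, [/\ exists2 b, b \in lattice_simplex m (n%:Z - 1) & T = G b, F \subset T &
    s = root_hull F]]%classic.

Lemma col_triangulationP : is_triangulation col_triangulation.
Proof.
apply: (triangulation_of_trees (G := fun T => exists2 b, b \in lattice_simplex m (n%:Z - 1) &
  T = G b)).
- by move=> T [b bL ->]; case: (col_graph_tree bL).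
- by move=> x /col_graph_cover[b bL cx]; exists (G b) => //; exists b.
- by move=> T T' w w' [b bL ->] [b' b'L ->]; exact: col_graph_compatible.
Qed.

Lemma tree_of_col_triangulation b : b \in lattice_simplex m (n%:Z - 1) ->
  tree_of col_triangulation b = G b.
Proof.
move=> bL; rewrite -{1}(col_graph_LDminus bL); apply: (tree_of_LD hm hn col_triangulationP).
split; first exact: col_graph_tree.
by exists (G b), (G b); split=> //; exists b.
Qed.

End FromColouring.

(** * The bijection *)

Theorem theorem3p6 (R : realType) (m n : nat) (hm : (1 <= m)%N) (hn : (1 <= n)%N) :
  set_bij
    [set tau : set (set 'rV[R]_(m + n)) | is_triangulation tau]%classic
    [set T : edge m n -> {set 'I_n} | is_trianguloid T]%classic
    (@trianguloid_of R m n).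
Proof.
split.
- by move=> tau; exact: trianguloid_of_is_trianguloid.
- by move=> tau tau' /set_mem H /set_mem H'; exact: trianguloid_of_inj.
- move=> T HT; have C := (trianguloid_colouringP T).1 HT.
  exists (@col_triangulation R m n (fun b i => at_edge T b (b + unit_vec i)));
    first exact: col_triangulationP.
  apply: colouring_inj => b i bL; rewrite at_trianguloid_of // tree_of_col_triangulation //.
  by apply/setP => j; rewrite !inE.
Qed.
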